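(* For every $n\geq 1$, the group $\Gamma_2(n)$ has a finite presentation with generators $E_{ij}$ and $F_i$, for $1\leq i,j\leq n$ with $i\neq j$, and with the following relators, where $1\leq i,j,k,l\leq n$ range over all mutually different indices: (1) $F_i^2$; (2) $(E_{ij}F_i)^2$, $(E_{ij}F_j)^2$, $(F_iF_j)^2$ (when $n\geq 2$); (3)(a) $[E_{ij},E_{ik}]$, $[E_{ij},E_{kj}]$, $[E_{ij},F_k]$, $[E_{ij},E_{ki}]E_{kj}^2$ (when $n\geq 3$); (3)(b) $[E_{ji}F_jE_{ij}F_iE_{ki}^{-1}E_{kj},\;E_{ki}F_kE_{ik}F_iE_{ji}^{-1}E_{jk}]$ for $i<j<k$ (when $n\geq 3$); (4) $[E_{ij},E_{kl}]$ (when $n\geq 4$).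
   Context: $\Gamma_2(n)=\ker(GL(n;\mathbb{Z})\to GL(n;\mathbb{Z}_2))$, where $\mathbb{Z}_2=\mathbb{Z}/2\mathbb{Z}$ and the map is reduction mod $2$; it is the level $2$ principal congruence subgroup of $GL(n;\mathbb{Z})$. For $1\leq i,j\leq n$ with $i\neq j$, $E_{ij}$ denotes the $n\times n$ matrix whose $(i,j)$ entry is $2$, whose diagonal entries are $1$ and whose other entries are $0$; $F_i$ denotes the diagonal matrix whose $(i,i)$ entry is $-1$ and whose other diagonal entries are $1$. The generators of the presentation are identified with these matrices. Commutator convention: $[X,Y]=X^{-1}Y^{-1}XY$. *)

(* Defs.v *)
From HB Require Import structures.
From mathcomp Require Import all_boot all_order all_algebra.

Set Implicit Arguments.
Unset Strict Implicit.
Unset Printing Implicit Defensive.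

Import GRing.Theory.
Local Open Scope ring_scope.

(* Free groups, as reduced words: the letter (x, b) stands for x^-1 if b is   *)
(* true and for x otherwise.                                                  *)
Section FreeGroup.
Variable X : choiceType.

Definition letter : Type := (X * bool)%type.
Implicit Types (a b : letter) (u v w : seq letter).

Definition linv a : letter := (a.1, ~~ a.2).

Definition reduced w := sorted (fun a b => b != linv a) w.

Record free_group := Free { free_word :> seq letter; _ : reduced free_word }.

HB.instance Definition _ := [isSub for free_word].
HB.instance Definition _ := [Choice of free_group by <:].

Definition push a w :=
  if w is b :: w' then (if b == linv a then w' else a :: w) else [:: a].

Definition wmul u v := foldr push v u.
Definition winv w := rev (map linv w).

Lemma linvK : involutive linv.
Proof. by case=> x b; rewrite /linv /= negbK. Qed.

Lemma push_reduced a w : reduced w -> reduced (push a w).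
Proof.
case: w => // b w rw /=; case: eqP => [_|/eqP nba]; first exact: path_sorted rw.
by rewrite /reduced /= nba.
Qed.

Lemma wmul_reduced u v : reduced v -> reduced (wmul u v).
Proof. by move=> rv; elim: u => //= a u; apply: push_reduced. Qed.

Lemma push_linvK a w : reduced w -> push (linv a) (push a w) = w.
Proof.
case: w => [|b w] /=; first by rewrite linvK eqxx.
have [->|nba] := eqVneq b (linv a); last by rewrite /= linvK eqxx.
by case: w => //= c w /andP[/negPf->].
Qed.

Lemma push_linvKV a w : reduced w -> push a (push (linv a) w) = w.
Proof. by move/push_linvK=> /(_ (linv a)); rewrite linvK. Qed.

Lemma wmul_push a u v : reduced v -> wmul (push a u) v = push a (wmul u v).
Proof.
move=> rv; case: u => //= b u; case: (b =P _) => [->|_] //=.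
by rewrite push_linvKV ?wmul_reduced.
Qed.

Lemma wmulA u v w : reduced w -> wmul u (wmul v w) = wmul (wmul u v) w.
Proof. by move=> rw; elim: u => //= a u ->; rewrite wmul_push. Qed.

Lemma wmul_id w : reduced w -> wmul w [::] = w.
Proof.
elim: w => //= a w IHw raw; rewrite IHw; last exact: path_sorted raw.
by case: w raw {IHw} => //= b w /andP[/negPf->].
Qed.

Lemma winv_reduced w : reduced w -> reduced (winv w).
Proof.
rewrite /reduced /winv rev_sorted sorted_map; apply: sub_sorted => a b /=.
by apply: contra => /eqP/(can_inj linvK)->; rewrite linvK.
Qed.

Lemma wmulVw w v : reduced v -> wmul (winv w) (wmul w v) = v.
Proof.
move=> rv; elim: w => //= a w IHw.
rewrite /winv /= rev_cons /wmul foldr_rcons push_linvK ?wmul_reduced //.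
Qed.

Lemma winvK : involutive winv.
Proof. by move=> w; rewrite /winv map_rev revK mapK //; apply: linvK. Qed.

Definition free_mul (u v : free_group) := Free (wmul_reduced u (valP v)).
Definition free_one := @Free [::] isT.
Definition free_inv (u : free_group) := Free (winv_reduced (valP u)).

Lemma free_mulA : associative free_mul.
Proof. by move=> u v w; apply/val_inj/wmulA/valP. Qed.
Lemma free_mul1g : left_id free_one free_mul.
Proof. by move=> u; apply/val_inj. Qed.
Lemma free_mulg1 : right_id free_one free_mul.
Proof. by move=> u; apply/val_inj/wmul_id/valP. Qed.
Lemma free_mulVg : left_inverse free_one free_inv free_mul.
Proof.
move=> u; apply/val_inj => /=.
by rewrite -{2}(wmul_id (valP u)) wmulVw.
Qed.
Lemma free_mulgV : right_inverse free_one free_inv free_mul.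
Proof.
move=> u; apply/val_inj => /=.
rewrite -{1}[free_word u]winvK -{2}(wmul_id (winv_reduced (valP u))).
by rewrite wmulVw.
Qed.

HB.instance Definition _ := isGroup.Build free_group free_mulA free_mul1g
  free_mulg1 free_mulVg free_mulgV.

Definition fgen (x : X) : free_group := @Free [:: (x, false)] isT.

End FreeGroup.

Section Presentation.
Local Open Scope group_scope.

Definition eval_letter (X : choiceType) (G : groupType) (f : X -> G)
    (a : letter X) : G :=
  if a.2 then (f a.1)^-1 else f a.1.

Definition free_lift (X : choiceType) (G : groupType) (f : X -> G)
    (w : free_group X) : G :=
  \prod_(a <- free_word w) eval_letter f a.

Lemma free_lift_gen (X : choiceType) (G : groupType) (f : X -> G) x :
  free_lift f (fgen x) = f x.
Proof. by rewrite /free_lift big_seq1. Qed.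

Lemma free_lift_is_group_morphism (X : choiceType) (G : groupType)
    (f : X -> G) :
  {morph free_lift f : u v / u * v}.
Proof.
move=> u [v rv]; rewrite /free_lift /= {rv}.
elim: (free_word u) => [|a w IHw] /=; first by rewrite big_nil mul1g.
rewrite big_cons -mulgA -IHw; case: (wmul w v) => [|b t] /=.
  by rewrite big_seq1 big_nil mulg1.
case: eqP => [->|_]; last by rewrite big_cons.
rewrite big_cons /eval_letter /=.
by case: a.2 => /=; rewrite ?mulVKg ?mulKg ?mulKVg.
Qed.

Inductive normal_closure (G : groupType) (R : G -> Prop) : G -> Prop :=
| nclosure_rel r of R r : normal_closure R r
| nclosure1 : normal_closure R 1
| nclosureM x y of normal_closure R x & normal_closure R y :
    normal_closure R (x * y)
| nclosureV x of normal_closure R x : normal_closure R x^-1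
| nclosureJ x y of normal_closure R x : normal_closure R (x ^ y).

Definition is_presentation (X : choiceType) (G : groupType) (f : X -> G)
    (R : free_group X -> Prop) : Prop :=
  (forall g : G, exists w : free_group X, free_lift f w = g) /\
  (forall w : free_group X, free_lift f w = 1 <-> normal_closure R w).

Definition is_finite_presentation (X : finType) (G : groupType) (f : X -> G)
    (R : free_group X -> Prop) : Prop :=
  (exists s : seq (free_group X), forall r, R r <-> r \in s) /\ is_presentation f R.

End Presentation.

Section GeneralLinear.
Variables (R : comUnitRingType) (n : nat).

(* MathComp's {'GL_n[R]} requires R to be finite.                             *)
Record GL := MkGL { GLmx :> 'M[R]_n; _ : GLmx \in unitmx }.

HB.instance Definition _ := [isSub for GLmx].
HB.instance Definition _ := [Choice of GL by <:].

Lemma GL_mul_subproof (A B : GL) : A *m B \in unitmx.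
Proof. by rewrite unitmx_mul (valP A) (valP B). Qed.
Lemma GL_inv_subproof (A : GL) : invmx A \in unitmx.
Proof. by rewrite unitmx_inv (valP A). Qed.

Definition GL_mul A B := MkGL (GL_mul_subproof A B).
Definition GL_one := MkGL (unitmx1 R n).
Definition GL_inv A := MkGL (GL_inv_subproof A).

Lemma GL_mulA : associative GL_mul.
Proof. by move=> A B C; apply/val_inj/mulmxA. Qed.
Lemma GL_mul1g : left_id GL_one GL_mul.
Proof. by move=> A; apply/val_inj/mul1mx. Qed.
Lemma GL_mulg1 : right_id GL_one GL_mul.
Proof. by move=> A; apply/val_inj/mulmx1. Qed.
Lemma GL_mulVg : left_inverse GL_one GL_inv GL_mul.
Proof. by move=> A; apply/val_inj/mulVmx/valP. Qed.
Lemma GL_mulgV : right_inverse GL_one GL_inv GL_mul.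
Proof. by move=> A; apply/val_inj/mulmxV/valP. Qed.

HB.instance Definition _ := isGroup.Build GL GL_mulA GL_mul1g GL_mulg1
  GL_mulVg GL_mulgV.

End GeneralLinear.

Section GLMap.
Variables (R S : comUnitRingType) (f : {rmorphism R -> S}) (n : nat).

Lemma GL_map_subproof (A : GL R n) : map_mx f A \in unitmx.
Proof. by rewrite unitmxE det_map_mx rmorph_unit // -unitmxE (valP A). Qed.

Definition GL_map (A : GL R n) : GL S n := MkGL (GL_map_subproof A).

Lemma GL_map_is_monoid_morphism : monoid.monoid_morphism GL_map.
Proof.
by split=> [|A B]; apply/val_inj; rewrite /= ?map_mx1 ?map_mxM.
Qed.

HB.instance Definition _ := isUMagmaMorphism.Build (GL R n) (GL S n) GL_map
  GL_map_is_monoid_morphism.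

End GLMap.

Definition mod2 (n : nat) : GL int n -> GL 'Z_2 n :=
  @GL_map int 'Z_2 intr n.
HB.instance Definition _ n := UMagmaMorphism.on (@mod2 n).

Definition ker_mod2 (n : nat) : {pred GL int n} :=
  [pred A | mod2 A == 1%g].

Lemma ker_mod2_closed n : group_closed (@ker_mod2 n).
Proof.
split=> [|A B]; rewrite !inE ?gmulf1 // => /eqP A1 /eqP B1.
have -> : mod2 (A / B)%g = (mod2 A / mod2 B)%g by exact: gmulfF.
by rewrite A1 B1 divg1.
Qed.

Record Gamma2 (n : nat) :=
  MkGamma2 { Gamma2_val :> GL int n; _ : Gamma2_val \in @ker_mod2 n }.
HB.instance Definition _ n := [isSub for @Gamma2_val n].
HB.instance Definition _ n := [Choice of Gamma2 n by <:].
HB.instance Definition _ n := SubChoice_isSubGroup.Build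
  (GL int n) (@ker_mod2 n) (Gamma2 n) (@ker_mod2_closed n).

Section Generators.
Variable n : nat.

Definition Emx (i j : 'I_n) : 'M[int]_n := 1%:M + 2 *: delta_mx i j.
Definition Fmx (i : 'I_n) : 'M[int]_n :=
  diag_mx (\row_k (if k == i then -1 else 1)).

(* inl (i, j) indexes E_ij and inr i indexes F_i.                             *)
Definition offdiag : Type := {ij : 'I_n * 'I_n | ij.1 != ij.2}.
HB.instance Definition _ := Finite.on offdiag.
Definition gens : Type := (offdiag + 'I_n)%type.
HB.instance Definition _ := Finite.on gens.

Definition gens_mx (x : gens) : 'M[int]_n :=
  match x with
  | inl ij => Emx (val ij).1 (val ij).2
  | inr i => Fmx i
  end.

Lemma gens_unitmx x : gens_mx x \in unitmx.
Proof.
case: x => [[[i j] /= ij]|i] /=.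
  suff /mulmx1_unit[] : Emx i j *m (1%:M - 2 *: delta_mx i j) = 1%:M by [].
  rewrite /Emx mulmxDl mul1mx mulmxBr mulmx1 -scalemxAl -scalemxAr.
  by rewrite mul_delta_mx_0 1?eq_sym // !scaler0 subr0 addrNK.
suff /mulmx1_unit[] : Fmx i *m Fmx i = 1%:M by [].
rewrite /Fmx mulmx_diag -diag_const_mx; congr diag_mx.
by apply/rowP=> k; rewrite !mxE; case: eqP.
Qed.

Definition gens_GL x : GL int n := MkGL (gens_unitmx x).

Lemma gens_ker x : gens_GL x \in @ker_mod2 n.
Proof.
rewrite inE; apply/eqP/val_inj/matrixP=> a b.
case: x => [[[i j] ij]|i]; rewrite /= !mxE /=.
  by case: (a == b); case: (_ && _); apply/val_inj.
by case: (a == b); case: (_ == i); apply/val_inj.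
Qed.

Definition Gamma2_gen (x : gens) : Gamma2 n := MkGamma2 (gens_ker x).

(* For i = j this is the junk value 1; every use below has distinct indices.  *)
Definition E (i j : 'I_n) : free_group gens :=
  if insub (i, j) is Some ij then fgen (inl ij : gens) else 1%g.
Definition F (i : 'I_n) : free_group gens := fgen (inr i : gens).

Local Open Scope group_scope.

(* MathComp's [~ x, y] is x^-1 * y^-1 * x * y.                                *)
Inductive Gamma2_relator : free_group gens -> Prop :=
| rel_F2 (i : 'I_n) : Gamma2_relator (F i ^+ 2)
| rel_EFi (i j : 'I_n) of i != j : Gamma2_relator ((E i j * F i) ^+ 2)
| rel_EFj (i j : 'I_n) of i != j : Gamma2_relator ((E i j * F j) ^+ 2)
| rel_FF (i j : 'I_n) of i != j : Gamma2_relator ((F i * F j) ^+ 2)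
| rel_row (i j k : 'I_n) of uniq [:: i; j; k] :
    Gamma2_relator [~ E i j, E i k]
| rel_col (i j k : 'I_n) of uniq [:: i; j; k] :
    Gamma2_relator [~ E i j, E k j]
| rel_EFk (i j k : 'I_n) of uniq [:: i; j; k] :
    Gamma2_relator [~ E i j, F k]
| rel_EE (i j k : 'I_n) of uniq [:: i; j; k] :
    Gamma2_relator ([~ E i j, E k i] * E k j ^+ 2)
| rel_triple (i j k : 'I_n) of (i < j < k)%N :
    Gamma2_relator
      [~ E j i * F j * E i j * F i * (E k i)^-1 * E k j,
         E k i * F k * E i k * F i * (E j i)^-1 * E j k]
| rel_disjoint (i j k l : 'I_n) of uniq [:: i; j; k; l] :
    Gamma2_relator [~ E i j, E k l].

End Generators.

(* Main.v *)
Require Import Defs.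
From HB Require Import structures.
From mathcomp Require Import all_boot all_order all_algebra.
From mathcomp Require Import boolp generic_quotient zify.

(** Peak reduction. Let [Q] be the group given by the presentation, acting on
    Z^n through its map to Gamma_2(n), and let [b] be one of the active
    indices. The orbit of the basis vector [delta b] consists of vectors that
    are odd exactly in coordinate [b], so some E_ij^(+-1) shrinks the l^1-norm
    of such a vector unless it is [delta b] or its opposite. If two such
    reductions of [v] are available, their targets are joined by a path of
    vectors of norm smaller than that of [v], and the resulting loop is a
    consequence of the relators. By induction on the norm, each vector of the
    orbit determines a coset of the subgroup [stab] generated by the generators
    fixing [delta b], equivariantly; so a word fixing [delta b] lies in [stab].
    Such a word is a product of E_bj's times a word in the indices other than
    [b], and induction on the set of active indices shows that a word acting
    trivially is trivial in [Q].

    The relators (3)(b) are needed for one kind of loop only, namely for two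
    reductions of v_b by coordinates with the same absolute value. *)

Set Implicit Arguments.
Unset Strict Implicit.
Unset Printing Implicit Defensive.

Import Order.TTheory GRing.Theory Num.Theory.

(** * The quotient by a normal closure *)

Section NormalQuotient.
Local Open Scope group_scope.
Local Open Scope quotient_scope.
Variables (G : groupType) (R : G -> Prop).

(** [{eq_quot _}] asks for a boolean relation; classical reflection supplies one without deciding
    the word problem. *)
Definition ncl_equiv (u v : G) : bool := `[< normal_closure R (u^-1 * v) >].

Lemma ncl_equiv_refl : reflexive ncl_equiv.
Proof. by move=> u; apply/asboolP; rewrite mulVg; apply: nclosure1. Qed.

Lemma ncl_equiv_sym : symmetric ncl_equiv.
Proof.
by move=> u v; apply/asboolP/asboolP => /nclosureV; rewrite invgM invgK.
Qed.

Lemma ncl_equiv_trans : transitive ncl_equiv.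
Proof.
move=> v u w /asboolP uv /asboolP vw; apply/asboolP.
by move: (nclosureM uv vw); rewrite mulgA mulgK.
Qed.

Canonical ncl_equivRel :=
  EquivRel ncl_equiv ncl_equiv_refl ncl_equiv_sym ncl_equiv_trans.

Definition ncl_quot := {eq_quot ncl_equivRel}.
HB.instance Definition _ := Choice.on ncl_quot.
HB.instance Definition _ := EqQuotient.on ncl_quot.

Definition ncl_pi (u : G) : ncl_quot := \pi u.

Lemma ncl_piP u v : ncl_pi u = ncl_pi v <-> normal_closure R (u^-1 * v).
Proof.
split=> [/eqquotP/asboolP //|uv].
by apply/eqquotP/asboolP.
Qed.

Definition ncl_mul (x y : ncl_quot) := ncl_pi (repr x * repr y).
Definition ncl_inv (x : ncl_quot) := ncl_pi (repr x)^-1.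

Lemma ncl_pi_repr x : ncl_pi (repr x) = x.
Proof. exact: reprK. Qed.

Lemma ncl_mulE u v : ncl_mul (ncl_pi u) (ncl_pi v) = ncl_pi (u * v).
Proof.
rewrite /ncl_mul; set u' := repr _; set v' := repr _.
have /ncl_piP uu' : ncl_pi u' = ncl_pi u by apply: ncl_pi_repr.
have /ncl_piP vv' : ncl_pi v' = ncl_pi v by apply: ncl_pi_repr.
apply/ncl_piP; rewrite invgM.
have -> : v'^-1 * u'^-1 * (u * v) = (u'^-1 * u) ^ v' * (v'^-1 * v).
  by rewrite conjgE !mulgA mulgK.
by apply: nclosureM vv'; apply: nclosureJ.
Qed.

Lemma ncl_invE u : ncl_inv (ncl_pi u) = ncl_pi u^-1.
Proof.
rewrite /ncl_inv; set u' := repr _.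
have /ncl_piP uu' : ncl_pi u' = ncl_pi u by apply: ncl_pi_repr.
apply/ncl_piP; rewrite invgK.
have -> : u' * u^-1 = (u'^-1 * u)^-1 ^ u'^-1.
  by rewrite conjgE !invgM !invgK !mulgA mulgK.
by apply/nclosureJ/nclosureV.
Qed.

Lemma ncl_mulA : associative ncl_mul.
Proof.
move=> x y z; rewrite -[x]ncl_pi_repr -[y]ncl_pi_repr -[z]ncl_pi_repr.
by rewrite !ncl_mulE mulgA.
Qed.
Lemma ncl_mul1g : left_id (ncl_pi 1) ncl_mul.
Proof. by move=> x; rewrite -[x]ncl_pi_repr ncl_mulE mul1g. Qed.
Lemma ncl_mulg1 : right_id (ncl_pi 1) ncl_mul.
Proof. by move=> x; rewrite -[x]ncl_pi_repr ncl_mulE mulg1. Qed.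
Lemma ncl_mulVg : left_inverse (ncl_pi 1) ncl_inv ncl_mul.
Proof.
by move=> x; rewrite -[x]ncl_pi_repr ncl_invE ncl_mulE mulVg.
Qed.
Lemma ncl_mulgV : right_inverse (ncl_pi 1) ncl_inv ncl_mul.
Proof.
by move=> x; rewrite -[x]ncl_pi_repr ncl_invE ncl_mulE mulgV.
Qed.

HB.instance Definition _ := isGroup.Build ncl_quot ncl_mulA ncl_mul1g
  ncl_mulg1 ncl_mulVg ncl_mulgV.

Lemma ncl_pi_is_monoid_morphism : monoid.monoid_morphism ncl_pi.
Proof. by split=> [|u v] //; apply/esym/ncl_mulE. Qed.

HB.instance Definition _ := isUMagmaMorphism.Build G ncl_quot ncl_pi
  ncl_pi_is_monoid_morphism.

Lemma ncl_pi_eq1 u : ncl_pi u = 1 <-> normal_closure R u.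
Proof.
split=> [u1|Ru].
  have /ncl_piP: ncl_pi 1 = ncl_pi u by rewrite u1 gmulf1.
  by rewrite invg1 mul1g.
rewrite -[1](gmulf1 (s := ncl_pi)); apply/esym/ncl_piP; rewrite invg1 mul1g //.
Qed.

End NormalQuotient.

Ltac ord_uniq :=
  repeat match goal with
  | H : is_true (uniq _) |- _ => revert H
  | H : is_true (~~ (_ == _)) |- _ => revert H
  end; rewrite /= ?inE; try rewrite -!val_eqE /=; clear; lia.

(** * The relators as signed commutation rules in an abstract group *)

Section Level2Relations.
Local Open Scope group_scope.

(* [e i j s] stands for E_ij^-1 if [s] is true and for E_ij otherwise. *)
Record level2_relations (n : nat) (Q : groupType)
    (e : 'I_n -> 'I_n -> bool -> Q) (f : 'I_n -> Q) : Prop := Level2Relations {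
  l2_f2 (i : 'I_n) : f i * f i = 1;
  l2_eV (i j : 'I_n) (s : bool) : (e i j s)^-1 = e i j (~~ s);
  l2_fC (i j : 'I_n) : f i * f j = f j * f i;
  l2_fe_row (i j : 'I_n) (s : bool) : i != j ->
    f i * e i j s = e i j (~~ s) * f i;
  l2_fe_col (i j : 'I_n) (s : bool) : i != j ->
    f j * e i j s = e i j (~~ s) * f j;
  l2_fe_other (i j k : 'I_n) (s : bool) : uniq [:: i; j; k] ->
    f k * e i j s = e i j s * f k;
  l2_e_row (i j k : 'I_n) (s t : bool) : uniq [:: i; j; k] ->
    e i j s * e i k t = e i k t * e i j s;
  l2_e_col (i j k : 'I_n) (s t : bool) : uniq [:: i; j; k] ->
    e i j s * e k j t = e k j t * e i j s;
  l2_e_disj (i j k l : 'I_n) (s t : bool) : uniq [:: i; j; k; l] ->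
    e i j s * e k l t = e k l t * e i j s;
  l2_e_chain (i j k : 'I_n) (s t : bool) : uniq [:: i; j; k] ->
    e i j s * e k i t =
    e k i t * e i j s * (e k j (~~ (s (+) t)) * e k j (~~ (s (+) t)));
  l2_triple (i j k : 'I_n) : (i < j < k)%N ->
    commute
      (e j i false * f j * e i j false * f i * e k i true * e k j false)
      (e k i false * f k * e i k false * f i * e j i true * e j k false)
}.

End Level2Relations.

(** * The rules hold in the presented group *)

Section Relations.
Local Open Scope group_scope.
Variable n : nat.
Implicit Types i j k l : 'I_n.

Definition G2pres : groupType := ncl_quot (@Gamma2_relator n).
Definition pi2 : free_group (gens n) -> G2pres := @ncl_pi _ (@Gamma2_relator n).
HB.instance Definition _ := UMagmaMorphism.on pi2.

Definition pE i j (s : bool) : G2pres :=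
  if s then (pi2 (E i j))^-1 else pi2 (E i j).
Definition pF i : G2pres := pi2 (F i).

Lemma pi2M : {morph pi2 : u v / u * v}.
Proof. exact: gmulfM. Qed.

Lemma pi2X m : {morph pi2 : u / u ^+ m}.
Proof. exact: gmulfXn. Qed.

Lemma pi2R : {morph pi2 : u v / [~ u, v]}.
Proof. exact: gmulfR. Qed.

Lemma pi2_rel r : Gamma2_relator r -> pi2 r = 1.
Proof. by move=> rr; apply/ncl_pi_eq1/nclosure_rel. Qed.

Lemma pF_sq i : pF i * pF i = 1.
Proof. by rewrite /pF -expg2 -pi2X pi2_rel //; exact: rel_F2. Qed.

Lemma pF_inv i : (pF i)^-1 = pF i.
Proof. by apply: mulg1_eq; apply: pF_sq. Qed.

Lemma pE_inv i j s : (pE i j s)^-1 = pE i j (~~ s).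
Proof. by case: s => //=; rewrite invgK. Qed.

Lemma pi2V : {morph pi2 : u / u^-1}.
Proof. exact: gmulfV. Qed.

Lemma commute_pE (x : G2pres) i j s :
  commute x (pi2 (E i j)) -> commute x (pE i j s).
Proof. by case: s => // /commuteV. Qed.

Lemma invol_conjV (G : groupType) (x y : G) :
  y * y = 1 -> (x * y) * (x * y) = 1 -> y * x = x^-1 * y.
Proof.
move=> yy xy; apply: (mulgI x); rewrite mulVKg.
by apply: (mulIg y); rewrite yy -xy !mulgA.
Qed.

Lemma invol_swap (G : groupType) (y x x' : G) :
  y * y = 1 -> y * x = x' * y -> y * x' = x * y.
Proof.
move=> yy yx; have -> : x' = y * x * y by rewrite yx -mulgA yy mulg1.
by rewrite !mulgA yy mul1g.
Qed.

Lemma commute_chain_invr (G : groupType) (a b z : G) :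
  a * b = b * a * z -> commute z b -> a * b^-1 = b^-1 * a * z^-1.
Proof.
move=> ab zb; apply: (mulgI b); apply: (mulIg (z * b)).
have -> : b * (a * b^-1) * (z * b) = b * a * z by rewrite zb !mulgA mulgVK.
by rewrite !mulgA mulgV mul1g mulgVK.
Qed.

Lemma commute_chain_invl (G : groupType) (a b z : G) :
  a * b = b * a * z -> commute z a -> a^-1 * b = b * a^-1 * z^-1.
Proof.
move=> ab za; apply: (mulgI a); apply: (mulIg (z * a)).
have -> : a * (a^-1 * b) * (z * a) = b * a * z by rewrite mulVKg za !mulgA.
by rewrite !mulgA !mulgVK.
Qed.

Lemma pFE_row i j s : i != j -> pF i * pE i j s = pE i j (~~ s) * pF i.
Proof.
move=> ij; have pfe : pF i * pE i j false = pE i j true * pF i.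
  apply: invol_conjV (pF_sq i) _; rewrite /pE /pF -expg2 -pi2M -pi2X.
  by rewrite pi2_rel //; exact: rel_EFi.
by case: s => //=; apply: invol_swap (pF_sq i) pfe.
Qed.

Lemma pFE_col i j s : i != j -> pF j * pE i j s = pE i j (~~ s) * pF j.
Proof.
move=> ij; have pfe : pF j * pE i j false = pE i j true * pF j.
  apply: invol_conjV (pF_sq j) _; rewrite /pE /pF -expg2 -pi2M -pi2X.
  by rewrite pi2_rel //; exact: rel_EFj.
by case: s => //=; apply: invol_swap (pF_sq j) pfe.
Qed.

Lemma pFC i j : pF i * pF j = pF j * pF i.
Proof.
have [->//|ij] := eqVneq i j.
rewrite -{1}[pF i]pF_inv; apply/esym/(invol_conjV (pF_sq j)).
by rewrite /pF -expg2 -pi2M -pi2X pi2_rel //; exact: rel_FF.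
Qed.

Lemma pFE_other i j k s : uniq [:: i; j; k] ->
  pF k * pE i j s = pE i j s * pF k.
Proof.
move=> u; apply: commute_pE; apply/commute_sym/commgP.
by apply/eqP; rewrite -pi2R pi2_rel //; exact: rel_EFk.
Qed.

Lemma pE_commute i j k l s t : [~ pi2 (E i j), pi2 (E k l)] = 1 ->
  pE i j s * pE k l t = pE k l t * pE i j s.
Proof.
move/eqP/commgP => c; apply: commute_pE; apply: commute_sym; apply: commute_pE.
exact: commute_sym.
Qed.

Lemma pE_row i j k s t : uniq [:: i; j; k] ->
  pE i j s * pE i k t = pE i k t * pE i j s.
Proof.
by move=> u; apply: pE_commute; rewrite -pi2R pi2_rel //; exact: rel_row.
Qed.

Lemma pE_col i j k s t : uniq [:: i; j; k] ->
  pE i j s * pE k j t = pE k j t * pE i j s.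
Proof.
by move=> u; apply: pE_commute; rewrite -pi2R pi2_rel //; exact: rel_col.
Qed.

Lemma pE_disj i j k l s t : uniq [:: i; j; k; l] ->
  pE i j s * pE k l t = pE k l t * pE i j s.
Proof.
by move=> u; apply: pE_commute; rewrite -pi2R pi2_rel //; exact: rel_disjoint.
Qed.

(** For signs σ, τ of the two factors the correction is E_kj^(-2στ). The relator is the case of two
    positive signs; as E_kj commutes with E_ij and E_ki, the factors can be inverted one at a
    time. *)
Lemma pE_chain i j k s t : uniq [:: i; j; k] ->
  pE i j s * pE k i t =
  pE k i t * pE i j s * (pE k j (~~ (s (+) t)) * pE k j (~~ (s (+) t))).
Proof.
move=> u; have u' : uniq [:: k; j; i] by ord_uniq.
have u'' : uniq [:: k; i; j] by ord_uniq.
set z := fun b => pE k j b * pE k j b.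
have za b c : commute (z b) (pE i j c).
  by apply: commute_sym; apply: commuteM; apply: pE_col.
have zb b c : commute (z b) (pE k i c).
  by apply: commute_sym; apply: commuteM; apply: pE_row.
have zV b : (z b)^-1 = z (~~ b) by rewrite invgM !pE_inv.
have ab : pE i j false * pE k i false = pE k i false * pE i j false * z true.
  have := pi2_rel (rel_EE u); rewrite pi2M pi2R pi2X expg2 => ab.
  have -> : z true = (z false)^-1 by rewrite zV.
  by rewrite [LHS]commgC; congr (_ * _); rewrite -[LHS]invgK (mulg1_eq ab).
have ab' := commute_chain_invr ab (zb _ _); rewrite zV !pE_inv in ab'.
case: s; case: t => //=.
- have := commute_chain_invl ab' (za _ _); by rewrite zV !pE_inv.
- have := commute_chain_invl ab (za _ _); by rewrite zV !pE_inv.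
Qed.

Lemma pE_triple i j k : (i < j < k)%N ->
  commute
    (pE j i false * pF j * pE i j false * pF i * pE k i true * pE k j false)
    (pE k i false * pF k * pE i k false * pF i * pE j i true * pE j k false).
Proof.
move=> ijk; apply/commgP/eqP; have := pi2_rel (rel_triple ijk).
by rewrite pi2R !pi2M !pi2V.
Qed.

Lemma pres_relations : level2_relations pE pF.
Proof.
by split; [exact: pF_sq | exact: pE_inv | exact: pFC | exact: pFE_row
  | exact: pFE_col | exact: pFE_other | exact: pE_row | exact: pE_col
  | exact: pE_disj | exact: pE_chain | exact: pE_triple].
Qed.

End Relations.

(** * Relation (3)(b) as a relation between three involutions *)

Section Involutions.
Local Open Scope group_scope.
Variables (n : nat) (Q : groupType) (e : 'I_n -> 'I_n -> bool -> Q)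
  (f : 'I_n -> Q).
Hypothesis rel : level2_relations e f.
Implicit Types i j k l b : 'I_n.

Let f2 := l2_f2 rel.
Let eV := l2_eV rel.
Let fC := l2_fC rel.
Let fe_row := l2_fe_row rel.
Let fe_col := l2_fe_col rel.
Let fe_other := l2_fe_other rel.
Let e_row := l2_e_row rel.
Let e_col := l2_e_col rel.
Let e_chain := l2_e_chain rel.

Lemma e_mulV i j s : e i j s * e i j (~~ s) = 1.
Proof. by rewrite -eV mulgV. Qed.

Lemma l2_fV i : (f i)^-1 = f i.
Proof. by apply: mulg1_eq; apply: f2. Qed.

Lemma e_mulVg x i j s : x * e i j s * e i j (~~ s) = x.
Proof. by rewrite -mulgA e_mulV mulg1. Qed.

Lemma f_mulV x i : x * f i * f i = x.
Proof. by rewrite -mulgA f2 mulg1. Qed.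

Lemma e_Vmulg x i j s : x * e i j (~~ s) * e i j s = x.
Proof. by rewrite -{2}[s]negbK e_mulVg. Qed.

Lemma xe_tf x i j : x * e i j true * e i j false = x.
Proof. exact: (e_mulVg x i j true). Qed.

Lemma xe_ft x i j : x * e i j false * e i j true = x.
Proof. exact: (e_mulVg x i j false). Qed.

Lemma xfC x i j : x * f i * f j = x * f j * f i.
Proof. by rewrite -mulgA fC mulgA. Qed.

Lemma xfe_row x i j s : i != j -> x * f i * e i j s = x * e i j (~~ s) * f i.
Proof. by move=> ij; rewrite -mulgA fe_row // mulgA. Qed.

Lemma xfe_col x i j s : i != j -> x * f j * e i j s = x * e i j (~~ s) * f j.
Proof. by move=> ij; rewrite -mulgA fe_col // mulgA. Qed.

Lemma xfe_other x i j k s : uniq [:: i; j; k] ->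
  x * f k * e i j s = x * e i j s * f k.
Proof. by move=> u; rewrite -mulgA fe_other // mulgA. Qed.

Lemma xe_row x i j k s t : uniq [:: i; j; k] ->
  x * e i j s * e i k t = x * e i k t * e i j s.
Proof. by move=> u; rewrite -mulgA e_row // mulgA. Qed.

Lemma xe_col x i j k s t : uniq [:: i; j; k] ->
  x * e i j s * e k j t = x * e k j t * e i j s.
Proof. by move=> u; rewrite -mulgA e_col // mulgA. Qed.

Lemma xe_chain x i j k s t : uniq [:: i; j; k] ->
  x * e i j s * e k i t =
  x * e k i t * e i j s * e k j (~~ (s (+) t)) * e k j (~~ (s (+) t)).
Proof. by move=> u; rewrite -mulgA e_chain // !mulgA. Qed.

Lemma xe_chainV x i j k s t : uniq [:: i; j; k] ->
  x * e k i t * e i j s =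
  x * e i j s * e k i t * e k j (s (+) t) * e k j (s (+) t).
Proof.
move=> u; rewrite (xe_chain _ _ _ u); have := e_Vmulg; set c := (s (+) t).
by move=> cV; rewrite !cV.
Qed.

(* [tau i j k] maps [v] to [v - 2 v_i (1, 1, 1)] in the coordinates [i], [j],
   [k]. The two entries of the commutator (3)(b) are products of two such
   involutions, and (3)(b) amounts to (tau_i tau_j tau_k)^2 = 1, which is
   symmetric in the three indices. *)
Definition tau i j k := e j i false * e k i false * f i.

Lemma tau_sym i j k : uniq [:: i; j; k] -> tau i j k = tau i k j.
Proof. by move=> u; rewrite /tau e_col //; ord_uniq. Qed.

Lemma tau2 i j k : uniq [:: i; j; k] -> tau i j k * tau i j k = 1.
Proof.
move=> u; rewrite {1}tau_sym // /tau !mulgA.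
have ji : j != i by ord_uniq.
have ki : k != i by ord_uniq.
by rewrite (xfe_col _ _ ji) e_mulVg (xfe_col _ _ ki) e_mulV mul1g f2.
Qed.

Lemma tau_mul i j k : uniq [:: i; j; k] ->
  tau i j k * tau j i k =
  e j i false * f j * e i j false * f i * e k i true * e k j false.
Proof.
move=> u; rewrite /tau.
have ij : i != j by ord_uniq.
have ki : k != i by ord_uniq.
have kj : k != j by ord_uniq.
have kij : uniq [:: k; i; j] by ord_uniq.
have kji : uniq [:: k; j; i] by ord_uniq.
rewrite !mulgA !(xfe_row _ _ ij, xfe_col _ _ ij, xfe_col _ _ ki,
  xfe_col _ _ kj, xfe_other _ _ kji, xfe_other _ _ kij) /=.
by rewrite (xe_chainV _ _ _ u) /= xe_tf (xfC _ i).
Qed.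

Lemma triple_tau i j k : (i < j < k)%N ->
  commute (tau i j k * tau j i k) (tau i j k * tau k i j).
Proof.
move=> ijk; have u : uniq [:: i; j; k] by rewrite /= !inE -!val_eqE /=; lia.
rewrite tau_mul // (tau_sym u) tau_mul; last by ord_uniq.
exact: (l2_triple rel).
Qed.

(** For involutions, (xy)(xz) = (xz)(xy) cancels to yxz = zxy; multiplying by xy on the left and yx
    on the right gives xyz = zyx. *)
Lemma tau_rev_lt i j k : (i < j < k)%N ->
  tau i j k * tau j i k * tau k i j = tau k i j * tau j i k * tau i j k.
Proof.
move=> ijk; have u : uniq [:: i; j; k] by rewrite /= !inE -!val_eqE /=; lia.
have := triple_tau ijk; have /tau2 := u.
have /tau2 : uniq [:: j; i; k] by ord_uniq.
have /tau2 : uniq [:: k; i; j] by ord_uniq.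
move: (tau i j k) (tau j i k) (tau k i j) => x y z zz yy xx.
rewrite /commute => c; apply: (mulgI (y * x)); apply: (mulIg (x * y)).
have -> : y * x * (x * y * z) * (x * y) = z * x * y.
  by rewrite !mulgA -(mulgA y) xx mulg1 yy mul1g.
have -> : y * x * (z * y * x) * (x * y) = y * x * z.
  by rewrite -!mulgA (mulgA x x) xx mul1g yy mulg1.
by apply: (mulgI x); move: c; rewrite !mulgA => ->.
Qed.

(** The identity xyz = zyx between involutions survives reversing and rotating the triple, and these
    permutations generate all orders of the indices. *)
Lemma tau_rev i j k : uniq [:: i; j; k] ->
  tau i j k * tau j i k * tau k i j = tau k i j * tau j i k * tau i j k.
Proof.
pose T i j k := tau i j k * tau j i k * tau k i j =
  tau k i j * tau j i k * tau i j k; rewrite -[_ = _]/(T i j k).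
have rev a b c : uniq [:: a; b; c] -> T a b c -> T c b a.
  move=> u; rewrite /T => abc; rewrite (tau_sym (i := c)); last by ord_uniq.
  rewrite (tau_sym (i := b)); last by ord_uniq.
  by rewrite (tau_sym (i := a)) ?abc //; ord_uniq.
have rot a b c : uniq [:: a; b; c] -> T a b c -> T b c a.
  move=> u; rewrite /T => abc; have aa := tau2 u.
  rewrite (tau_sym (i := b)); last by ord_uniq.
  rewrite (tau_sym (i := c)); last by ord_uniq.
  move: abc aa; move: (tau a b c) (tau b a c) (tau c a b) => x y z abc aa.
  apply: (mulgI x); rewrite !mulgA abc aa mul1g.
  by rewrite -mulgA aa mulg1.
move=> u; have : [|| i < j < k, i < k < j, j < i < k, j < k < i, k < i < j
  | k < j < i]%N.
  by ord_uniq.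
case/or4P=> [/tau_rev_lt//|/tau_rev_lt t|/tau_rev_lt t|/or3P[]/tau_rev_lt t].
- by apply: (rot _ _ _ _ (rot _ _ _ _ (rev _ _ _ _ t))); ord_uniq.
- by apply: (rot _ _ _ _ (rev _ _ _ _ t)); ord_uniq.
- by apply: (rot _ _ _ _ (rot _ _ _ _ t)); ord_uniq.
- by apply: (rot _ _ _ _ t); ord_uniq.
- by apply: (rev _ _ _ _ t); ord_uniq.
Qed.

(* [g] adds [2 (v_j - v_k)] to [v_i], [U] adds [-2 (v_j - v_k) (0, 1, 1)], and
   [x g x^-1] adds [2 (v_j - v_k) (1, 2, 2)] in the coordinates [i], [j],
   [k]. *)
Lemma row_difference_conj i j k : uniq [:: i; j; k] ->
  let x := e j i false * e k i false in
  let g := e i j false * e i k true in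
  let U := e k j false * f k * e j k false * f j in
  x * g = U^-1 * g * U^-1 * x.
Proof.
move=> u /=.
have ij : i != j by ord_uniq.
have ik : i != k by ord_uniq.
have ji : j != i by ord_uniq.
have ki : k != i by ord_uniq.
have kj : k != j by ord_uniq.
have jk : j != k by ord_uniq.
have ikj : uniq [:: i; k; j] by ord_uniq.
have kij : uniq [:: k; i; j] by ord_uniq.
have kji : uniq [:: k; j; i] by ord_uniq.
have jki : uniq [:: j; k; i] by ord_uniq.
have jik : uniq [:: j; i; k] by ord_uniq.
set x := e j i false * e k i false.
set g := e i j false * e i k true.
set U := e k j false * f k * e j k false * f j.
(* Rules that push every [f] to the right, at the cost of signs. *)
have fs := ((fun x s => xfe_row x s kj), (fun x s => xfe_col x s kj),
  (fun x s => xfe_row x s jk), (fun x s => xfe_col x s jk),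
  (fun x s => xfe_row x s ji), (fun x s => xfe_row x s ki),
  (fun x s => xfe_col x s ij), (fun x s => xfe_col x s ik),
  (fun x s => xfe_row x s ij), (fun x s => xfe_row x s ik),
  (fun x s => xfe_col x s ji), (fun x s => xfe_col x s ki),
  (fun x s => xfe_other x s kij), (fun x s => xfe_other x s jik),
  (fun x s => xfe_other x s kji), (fun x s => xfe_other x s jki),
  (fun x s => xfe_other x s u), (fun x s => xfe_other x s ikj)).
have xU : x * U = U * x.
  rewrite /x /U !mulgA !fs /=.
  rewrite (xe_row _ _ _ kij) (e_chain _ _ jik) /= mulgA xe_tf.
  rewrite (xe_chain _ _ _ kij) /= (xe_row _ _ _ jik).
  by rewrite (xe_col _ false true jik) xe_ft (xe_col _ true true kij).
have Z : tau j i k * tau k i j = U * g^-1.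
  rewrite /g /U invgM !eV /tau !mulgA !fs /=.
  rewrite (e_col _ _ u) (xe_row _ _ _ u) (xe_chainV _ _ _ jki) /=.
  rewrite (xe_col _ _ _ ikj) (xe_row _ _ _ u) xe_ft (xe_row _ _ _ u).
  by rewrite xfC.
have fU : f i * U = U * f i.
  by rewrite /U !mulgA (fe_other _ kji) !fs xfC (xfC _ i).
have fg : f i * g^-1 = g * f i.
  by rewrite /g invgM !eV /= mulgA (fe_row _ ik) !fs /= (e_row _ _ u).
have ti : tau i j k = f i * x^-1.
  rewrite -[f i]l2_fV -invgM; apply/esym/mulg1_eq; exact: tau2.
(* By [tau_rev], tau_i conjugates tau_j tau_k = U g^-1 to its inverse. Writing tau_i both as x f_i
   and as f_i x^-1, and moving f_i across U and g, yields the claim. *)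
have ttt : tau i j k * (tau j i k * tau k i j) * tau i j k = g * U^-1.
  have -> : g * U^-1 = (tau j i k * tau k i j)^-1.
    by rewrite Z (invgM U) (invgK g).
  have := tau_rev u; have := tau2 u.
  have /tau2 : uniq [:: j; i; k] by ord_uniq.
  have /tau2 : uniq [:: k; i; j] by ord_uniq.
  move: (tau i j k) (tau j i k) (tau k i j) => y1 y2 y3 y33 y22 y11 yr.
  rewrite mulgA yr -mulgA y11 mulg1; apply/esym/mulg1_eq.
  by rewrite mulgA -(mulgA y2) y33 mulg1.
have tix : tau i j k = x * f i by [].
move: ttt; rewrite Z {1}tix ti.
move: x g U {tix ti Z} xU fU fg => x g U xU fU fg.
have -> : x * f i * (U * g^-1) * (f i * x^-1) = U * (x * g * x^-1).
  rewrite !mulgA -(mulgA x (f i) U) fU (mulgA x) xU -(mulgA _ (f i) g^-1) fg.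
  by rewrite !mulgA f_mulV.
move=> xUg; apply: (mulgI U); apply: (mulIg x^-1).
by rewrite -mulgA xUg !mulgA mulgV mul1g mulgK.
Qed.

Lemma fe_any i k l s : k != l ->
  f i * e k l s = e k l (s (+) (i == k) (+) (i == l)) * f i.
Proof.
move=> kl; have [->|ik] := eqVneq i k.
  by rewrite (negPf kl) addbF addbT fe_row.
have [->|il] := eqVneq i l; first by rewrite addbF addbT fe_col.
by rewrite !addbF fe_other //; ord_uniq.
Qed.

Lemma ef_any i k l s : k != l ->
  e k l s * f i = f i * e k l (s (+) (i == k) (+) (i == l)).
Proof.
by move=> kl; rewrite fe_any //; case: s; case: (i == k); case: (i == l).
Qed.

(** Conjugation by E_jl multiplies E_ij by E_il^-2. The left side is the detour taken in
    [conf_fork]. *)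
Lemma fork_word i j l : uniq [:: i; j; l] ->
  e j l false * e i j false * e j l true * e i l false =
  e i l true * e i j false.
Proof.
move=> u; have jli : uniq [:: j; l; i] by ord_uniq.
have ilj : uniq [:: i; l; j] by ord_uniq.
rewrite (e_chain _ _ jli) /= !mulgA !(xe_col _ _ _ ilj) xe_ft xe_tf.
exact: e_row.
Qed.

(** The same conjugation in the other direction, with E_il^2 split around E_ij; the left side is the
    path of [conf_chain]. *)
Lemma chain_word i j l : uniq [:: i; j; l] ->
  e i l false * e i j false * e i l false * e j l true =
  e j l true * e i j false.
Proof.
move=> u; have jli : uniq [:: j; l; i] by ord_uniq.
have ilj : uniq [:: i; l; j] by ord_uniq.
rewrite (e_chain _ _ jli) /= !mulgA !(xe_col _ _ _ jli).
by rewrite (e_row _ _ u).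
Qed.

(** Moving E_ij past E_jk creates the square of E_ik or of its inverse, and one factor of it
    cancels. The two sides are the paths compared in [desc_flip]. *)
Lemma flip_word i j k s t : uniq [:: i; j; k] ->
  e i j s * (e j k t * e i k (~~ (t (+) s))) =
  e j k t * (e i k (t (+) s) * e i j s).
Proof.
move=> u; have jki : uniq [:: j; k; i] by ord_uniq.
have := xe_chainV 1 t s jki; rewrite !mul1g !mulgA => ->.
by rewrite e_mulVg (xe_row _ _ _ u).
Qed.

End Involutions.

(** * The action on integer vectors *)

Section Vectors.
Variable n : nat.
Implicit Types (i j k l : 'I_n).

Definition vec := {ffun 'I_n -> int}.
Implicit Types v : vec.

Definition upd v i (a : int) : vec := [ffun k => if k == i then a else v k].

Definition incr (s : bool) (x y : int) : int :=
  (if s then x - 2 * y else x + 2 * y)%R.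

Definition actE v i j (s : bool) : vec := upd v i (incr s (v i) (v j)).

Definition actF v i : vec := upd v i (- v i)%R.

Definition nrm v : nat := \sum_i `|v i|%N.

Lemma updE v i a k : upd v i a k = if k == i then a else v k.
Proof. by rewrite ffunE. Qed.

(** Stated additively, so that [lia] never meets a truncated subtraction. *)
Lemma nrm_upd v i a : nrm (upd v i a) + `|v i| = nrm v + `|a|.
Proof.
rewrite /nrm (bigD1 i) //= [in RHS](bigD1 i) //= updE eqxx.
have -> : \sum_(k | k != i) `|upd v i a k| = \sum_(k | k != i) `|v k|.
  by apply: eq_bigr => k /negPf ki; rewrite updE ki.
by rewrite addnAC [RHS]addnAC; congr (_ + _); rewrite addnC.
Qed.

Lemma nrm_actE v i j s : nrm (actE v i j s) + `|v i| =
  nrm v + `|incr s (v i) (v j)|.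
Proof. exact: nrm_upd. Qed.

Lemma nrm_actF v i : nrm (actF v i) = nrm v.
Proof. by have := nrm_upd v i (- v i)%R; rewrite /actF; lia. Qed.

(** Most loops below move only three coordinates; in this form following them is arithmetic on
    integer triples. *)
Definition upd3 v i j l a c d : vec := upd (upd (upd v i a) j c) l d.

Lemma nrm_upd3 v i j l a c d : i != j -> i != l -> j != l ->
  nrm (upd3 v i j l a c d) + (`|v i| + `|v j| + `|v l|) =
  nrm v + (`|a| + `|c| + `|d|).
Proof.
move=> ij il jl; have := nrm_upd v i a; have := nrm_upd (upd v i a) j c.
have := nrm_upd (upd (upd v i a) j c) l d.
rewrite /upd3 !updE ![l == _]eq_sym ![j == i]eq_sym.
by rewrite (negPf ij) (negPf il) (negPf jl); clear; lia.
Qed.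

Lemma nrm_actE2 v i j k l s t : i != k -> i != l ->
  nrm (actE (actE v i j s) k l t) + `|v k| =
  nrm (actE v i j s) + `|incr t (v k) (v l)|.
Proof.
move=> ik il; have := nrm_actE (actE v i j s) k l t.
rewrite [actE v i j s k]updE [actE v i j s l]updE ![_ == i]eq_sym.
by rewrite (negPf ik) (negPf il).
Qed.

Lemma le_nrm v i : `|v i| <= nrm v.
Proof. by rewrite /nrm (bigD1 i) //= leq_addr. Qed.

(** Subtracting 2y when x and y have the same sign, and adding it otherwise, turns |x| into the
    absolute value of |x| - 2|y|. *)
Lemma incr_reduce (x y : int) : y != 0%R -> `|y| < `|x| ->
  exists t, `|incr t x y| < `|x|.
Proof.
by move=> y0 yx; exists ((0 < x)%R == (0 < y)%R); rewrite /incr;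
  case: eqP; move: y0 yx; clear; lia.
Qed.

End Vectors.

Ltac eq_simp :=
  repeat match goal with
  | |- context [?x == ?x] => rewrite (eqxx x)
  | H : is_true (?x != ?y) |- context [?x == ?y] => rewrite (negPf H)
  | H : is_true (?x != ?y) |- context [?y == ?x] =>
      rewrite (eq_sym y x) (negPf H)
  end.

Ltac vec_eq :=
  let m := fresh "m" in
  apply/ffunP => m; rewrite /actE /actF /incr ?updE;
  repeat (eq_simp; rewrite /=;
    match goal with
    | |- context [m == ?y] => have [?|?] := eqVneq m y; [subst m|]
    end);
  eq_simp; rewrite /=; try by [clear; lia | lia].

Section VectorIdentities.
Variable n : nat.
Implicit Types (i j k l : 'I_n) (v : vec n) (a c d : int).

Lemma actEK v i j s : i != j -> actE (actE v i j s) i j (~~ s) = v.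
Proof. by move=> ij; case: s; vec_eq. Qed.

Lemma actEC v i j k l s t : i != j -> k != l -> i != l -> k != j ->
  actE (actE v i j s) k l t = actE (actE v k l t) i j s.
Proof.
by move=> ij kl il kj; have [ik|ki] := eqVneq i k; [subst k|];
  case: s; case: t; vec_eq.
Qed.

Lemma actFK v i : actF (actF v i) i = v.
Proof. by vec_eq. Qed.

Lemma actFC v i j : actF (actF v i) j = actF (actF v j) i.
Proof. by have [->//|ij] := eqVneq i j; vec_eq. Qed.

Lemma actF_fix v i : v i = 0%R -> actF v i = v.
Proof. by move=> vi; vec_eq; rewrite vi. Qed.

Lemma actE_fix v i j s : v j = 0%R -> actE v i j s = v.
Proof.
move=> vj; apply/ffunP=> k; rewrite updE /incr vj mulr0 subr0 ?addr0 if_same.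
by case: eqP => [->|].
Qed.

Lemma actFE v i k l s : k != l ->
  actF (actE v k l s) i = actE (actF v i) k l (s (+) (i == k) (+) (i == l)).
Proof.
move=> kl; have [ik|ik] := eqVneq i k.
  by subst k; rewrite (negPf kl); case: s; vec_eq.
have [il|il] := eqVneq i l; first by subst l; case: s; vec_eq.
by case: s; vec_eq.
Qed.

Section Distinct.
Variables (v : vec n) (i j l : 'I_n).
Hypotheses (ij : i != j) (il : i != l) (jl : j != l).
Notation W := (upd3 v i j l).

Lemma upd3_id : v = W (v i) (v j) (v l).
Proof using ij il jl. by rewrite /upd3; vec_eq. Qed.

Lemma actE_upd3_ij a c d s : actE (W a c d) i j s = W (incr s a c) c d.
Proof using ij il jl. by rewrite /upd3; vec_eq. Qed.

Lemma actE_upd3_il a c d s : actE (W a c d) i l s = W (incr s a d) c d.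
Proof using ij il jl. by rewrite /upd3; vec_eq. Qed.

Lemma actE_upd3_ji a c d s : actE (W a c d) j i s = W a (incr s c a) d.
Proof using ij il jl. by rewrite /upd3; vec_eq. Qed.

Lemma actE_upd3_jl a c d s : actE (W a c d) j l s = W a (incr s c d) d.
Proof using ij il jl. by rewrite /upd3; vec_eq. Qed.

Lemma actE_upd3_li a c d s : actE (W a c d) l i s = W a c (incr s d a).
Proof using ij il jl. by rewrite /upd3; vec_eq. Qed.

Lemma actE_upd3_lj a c d s : actE (W a c d) l j s = W a c (incr s d c).
Proof using ij il jl. by rewrite /upd3; vec_eq. Qed.

Lemma actF_upd3_j a c d : actF (W a c d) j = W a (- c)%R d.
Proof using ij il jl. by rewrite /upd3; vec_eq. Qed.

Lemma actF_upd3_l a c d : actF (W a c d) l = W a c (- d)%R.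
Proof using ij il jl. by rewrite /upd3; vec_eq. Qed.

Definition actE_upd3 := (actE_upd3_ij, actE_upd3_il, actE_upd3_ji,
  actE_upd3_jl, actE_upd3_li, actE_upd3_lj, actF_upd3_j, actF_upd3_l).

End Distinct.
End VectorIdentities.

(** * Peak reduction *)

Section PeakReduction.
Local Open Scope group_scope.
Variables (n : nat) (Q : groupType) (e : 'I_n -> 'I_n -> bool -> Q)
  (f : 'I_n -> Q).
Hypothesis rel : level2_relations e f.
Variables (A : {set 'I_n}) (b : 'I_n).
Hypothesis bA : b \in A.
Implicit Types (i j k l : 'I_n) (u v w : vec n) (g h q x : Q).

Definition delta : vec n := [ffun k => Posz (k == b)].

(** Inverses need no constructor: both signs of E_ij are allowed and F_i is an involution. *)
Inductive stab : Q -> Prop :=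
| stab1 : stab 1
| stabE i j s x of i \in A & j \in A & i != j & j != b & stab x :
    stab (e i j s * x)
| stabF i x of i \in A & i != b & stab x : stab (f i * x).

(* [desc v q]: some norm-reducing path from [v] to [delta] or its opposite
   selects the coset of [q] modulo [stab]; in particular [q] maps [delta] to
   [v]. *)
Inductive desc : vec n -> Q -> Prop :=
| desc_base x of stab x : desc delta x
| desc_neg x of stab x : desc (actF delta b) (f b * x)
| desc_up v q i j s of i \in A & j \in A & i != j &
    (nrm (actE v i j s) < nrm v)%N & desc (actE v i j s) (e i j s * q) :
    desc v q.

(** Multiplication by [g] carries the coset attached to [u] exactly onto the one attached to [v];
    closing a loop at a peak means proving an edge between two reductions. *)
Definition edge g u v := forall q, desc u q <-> desc v (g * q).

Lemma edge_comp g h u v w : edge g u v -> edge h v w -> edge (h * g) u w.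
Proof. by move=> uv vw q; rewrite -mulgA uv vw. Qed.

Lemma edge_inv g u v : edge g u v -> edge g^-1 v u.
Proof. by move=> uv q; rewrite uv mulVKg. Qed.

(** Generators are the identity modulo 2, so the parities of [delta] persist. Hence coordinate [b]
    never vanishes and never ties in absolute value with another one. *)
Lemma desc_odd v q : desc v q -> forall i, odd `|v i| = (i == b).
Proof.
elim=> {v q} [x _ i|x _ i|v q i j s _ _ ij _ _ IH k].
- by rewrite ffunE; case: (i == b).
- by rewrite updE !ffunE eqxx; case: (i == b).
have := IH k; rewrite /actE updE /incr; have [->|//] := eqVneq k i.
by move=> <-; case: (s); clear; lia.
Qed.

Lemma delta_off i : i != b -> delta i = 0%R.
Proof. by move=> ib; rewrite ffunE (negPf ib). Qed.

(** Sign changes preserve the norm and commute with each E_kl up to its sign, so a whole descent can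
    be transported. *)
Lemma desc_actF v i q : i \in A -> desc v q -> desc (actF v i) (f i * q).
Proof.
move=> iA; elim=> {v q} [x sx|x sx|v q k l s kA lA kl lt _ IH].
- have [->|ib] := eqVneq i b; first exact: desc_neg.
  by rewrite actF_fix ?delta_off //; apply/desc_base/stabF.
- have [->|ib] := eqVneq i b.
    by rewrite actFK mulgA (l2_f2 rel) mul1g; apply: desc_base.
  rewrite actFC (actF_fix (delta_off ib)) mulgA (l2_fC rel) -mulgA.
  exact/desc_neg/stabF.
apply: (desc_up kA lA kl (s := s (+) (i == k) (+) (i == l))).
  by rewrite -actFE // !nrm_actF.
by rewrite mulgA -(fe_any rel) // -mulgA -actFE.
Qed.

Lemma edgeF v i : i \in A -> edge (f i) v (actF v i).
Proof.
move=> iA q; split; first exact: desc_actF.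
by move/(desc_actF iA); rewrite actFK mulgA (l2_f2 rel) mul1g.
Qed.

(** * Closing the loops at a peak of norm at most [N] *)

Section Below.
Variable N : nat.
(** The induction hypothesis on the norm, discharged in [desc_actE]. *)
Hypothesis below : forall v i j s, i \in A -> j \in A -> i != j ->
  (nrm v < N)%N -> (nrm (actE v i j s) < N)%N ->
  edge (e i j s) v (actE v i j s).

Lemma belowE u v i j s : i \in A -> j \in A -> i != j ->
  v = actE u i j s -> (nrm u < N)%N -> (nrm v < N)%N -> edge (e i j s) u v.
Proof. by move=> iA jA ij -> *; apply: below. Qed.

Lemma conf_square v i j k l s t : i \in A -> j \in A -> k \in A -> l \in A ->
  i != j -> k != l -> i != l -> k != j ->
  e i j (~~ s) * e k l t = e k l t * e i j (~~ s) ->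
  (nrm (actE v i j s) < N)%N -> (nrm (actE v k l t) < N)%N ->
  (nrm (actE (actE v i j s) k l t) < N)%N ->
  edge (e k l t * e i j (~~ s)) (actE v i j s) (actE v k l t).
Proof.
move=> iA jA kA lA ij kl il kj eC n1 n2 n12.
rewrite -eC; apply: edge_comp; first exact: below.
by apply: belowE => //; rewrite actEC // actEK.
Qed.

Ltac below_step ij il jl lt l0 lj ji :=
  apply: belowE => //; [rewrite (actE_upd3 _ ij il jl); congr upd3;
    rewrite /incr; clear; lia | apply: lt; move: l0 lj ji; clear; lia ..].

(* The values of [v] are p > q > r > 0. The vector with p - 2q - 2r may exceed
   the norm of [v]; the path goes through p - 2q + 2r and replaces q by q - 2r
   in between. *)
Lemma conf_fork v i j l : i \in A -> j \in A -> l \in A -> uniq [:: i; j; l] ->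
  (nrm v <= N)%N -> (0 < v l < v j)%R -> (v j < v i)%R ->
  edge (e i l true * e i j false) (actE v i j true) (actE v i l true).
Proof.
move=> iA jA lA u vN /andP[l0 lj] ji.
have ij : i != j by ord_uniq.
have il : i != l by ord_uniq.
have jl : j != l by ord_uniq.
have lt a c : (`|a| + `|c| < `|v i| + `|v j|)%N ->
    (nrm (upd3 v i j l a c (v l)) < N)%N.
  by move: (nrm_upd3 v a c (v l) ij il jl) vN; clear; lia.
rewrite -(fork_word rel) // {1 2}(upd3_id v ij il jl).
rewrite !(actE_upd3 v ij il jl) /=.
move: (v i) (v j) (v l) lt l0 lj ji => p q r lt l0 lj ji.
set W := upd3 v i j l.
apply: (edge_comp (v := W (p - 2 * q + 2 * r)%R q%R r)).
  by below_step ij il jl lt l0 lj ji.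
apply: (edge_comp (v := W (p - 2 * q + 2 * r)%R (q - 2 * r)%R r)).
  by below_step ij il jl lt l0 lj ji.
apply: (edge_comp (v := W (p - 2 * r)%R (q - 2 * r)%R r)).
  by below_step ij il jl lt l0 lj ji.
below_step ij il jl lt l0 lj ji.
Qed.

(** For values p > q > r > 0, the path lowers the second coordinate to q - 2r first; the first one
    then runs through p - 2q, p - 2q + 2r, p - 2r, p. Undoing E_ij^-1 directly would give p - 4r,
    which may be too long. *)
Lemma conf_chain v i j l : i \in A -> j \in A -> l \in A -> uniq [:: i; j; l] ->
  (nrm v <= N)%N -> (0 < v l < v j)%R -> (v j < v i)%R ->
  edge (e j l true * e i j false) (actE v i j true) (actE v j l true).
Proof.
move=> iA jA lA u vN /andP[l0 lj] ji.
have ij : i != j by ord_uniq.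
have il : i != l by ord_uniq.
have jl : j != l by ord_uniq.
have lt a c : (`|a| + `|c| < `|v i| + `|v j|)%N ->
    (nrm (upd3 v i j l a c (v l)) < N)%N.
  by move: (nrm_upd3 v a c (v l) ij il jl) vN; clear; lia.
rewrite -(chain_word rel) // {1 2}(upd3_id v ij il jl).
rewrite !(actE_upd3 v ij il jl) /=.
move: (v i) (v j) (v l) lt l0 lj ji => p q r lt l0 lj ji.
set W := upd3 v i j l.
apply: (edge_comp (v := W (p - 2 * q)%R (q - 2 * r)%R r)).
  by below_step ij il jl lt l0 lj ji.
apply: (edge_comp (v := W (p - 2 * q + 2 * r)%R (q - 2 * r)%R r)).
  by below_step ij il jl lt l0 lj ji.
apply: (edge_comp (v := W (p - 2 * r)%R (q - 2 * r)%R r)).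
  by below_step ij il jl lt l0 lj ji.
below_step ij il jl lt l0 lj ji.
Qed.

(* Both reductions lead to the same vector u = (p - 2q, q, q), so the quotient
   [g] of the two generators has to preserve the coset attached to u. It is
   conjugated to the smaller vector (p - 2q, c, c), where the word given by
   [row_difference_conj] is followed letter by letter below the norm of [v]. *)
Lemma conf_row_lt v j l : j \in A -> l \in A -> uniq [:: b; j; l] ->
  (nrm v <= N)%N -> v j = v l -> (0 < v j < v b)%R -> (v b < 2 * v j)%R ->
  edge (e b l true * e b j false) (actE v b j true) (actE v b l true).
Proof.
move=> jA lA u vN jl_eq /andP[j0 jb] b2j.
have bj : b != j by ord_uniq.
have bl : b != l by ord_uniq.
have jl : j != l by ord_uniq.
have jb' : j != b by ord_uniq.
have lb' : l != b by ord_uniq.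
have lj' : l != j by ord_uniq.
have lt a c d : (`|a| + `|c| + `|d| < `|v b| + `|v j| + `|v l|)%N ->
    (nrm (upd3 v b j l a c d) < N)%N.
  by move: (nrm_upd3 v a c d bj bl jl) vN; clear; lia.
rewrite {1 2}(upd3_id v bj bl jl) !(actE_upd3 v bj bl jl) /=.
move: (v b) (v j) (v l) jl_eq lt j0 jb b2j => p q _ <- lt q0 qp p2q.
(* [c] is q after adding twice the entry p - 2q at [b]; |c| < q because 0 < 2q - p < q. *)
set W := upd3 v b j l; set c := (q - 2 * (2 * q - p))%R.
have ltu : (nrm (W (p - 2 * q)%R q q) < N)%N.
  by apply: lt; clear -q0 qp p2q; lia.
have ltm : (nrm (W (p - 2 * q)%R q c) < N)%N.
  by apply: lt; rewrite /c; clear -q0 qp p2q; lia.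
have ltw : (nrm (W (p - 2 * q)%R c c) < N)%N.
  by apply: lt; rewrite /c; clear -q0 qp p2q; lia.
have ltw1 : (nrm (W (p - 2 * q)%R (- c)%R c) < N)%N.
  by apply: lt; rewrite /c; clear -q0 qp p2q; lia.
have ltw2 : (nrm (W (p - 2 * q)%R c (- c)%R) < N)%N.
  by apply: lt; rewrite /c; clear -q0 qp p2q; lia.
have Ex : edge (e j b false * e l b false) (W (p - 2 * q)%R q q)
    (W (p - 2 * q)%R c c).
  apply: (edge_comp (v := W (p - 2 * q)%R q c)).
    apply: belowE => //; rewrite (actE_upd3 v bj bl jl); congr upd3.
    by rewrite /incr /c; clear; lia.
  apply: belowE => //; rewrite (actE_upd3 v bj bl jl); congr upd3.
  by rewrite /incr /c; clear; lia.
have EU : edge (e l j false * f l * e j l false * f j) (W (p - 2 * q)%R c c)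
    (W (p - 2 * q)%R c c).
  apply: (edge_comp (v := W (p - 2 * q)%R (- c)%R c)).
    by rewrite /W -(actF_upd3_j v bj bl jl); apply: edgeF.
  apply: (edge_comp (v := W (p - 2 * q)%R c c)).
    apply: belowE => //; rewrite (actE_upd3 v bj bl jl); congr upd3.
    by rewrite /incr; clear; lia.
  apply: (edge_comp (v := W (p - 2 * q)%R c (- c)%R)).
    by rewrite /W -(actF_upd3_l v bj bl jl); apply: edgeF.
  apply: belowE => //; rewrite (actE_upd3 v bj bl jl); congr upd3.
  by rewrite /incr; clear; lia.
have Eg : edge (e b j false * e b l true) (W (p - 2 * q)%R c c)
    (W (p - 2 * q)%R c c).
  (* Since p - 2q is negative, the one of the two commuting factors that adds 2|c| has to act first;
     the sign of [c] tells which one it is. *)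
  have [c0|c0] := lerP 0%R c.
    rewrite (l2_e_row rel) //.
    have ltc : (nrm (W (p - 2 * q + 2 * c)%R c c) < N)%N.
      by apply: lt; move: c0; rewrite /c; clear -q0 qp p2q; lia.
    apply: (edge_comp (v := W (p - 2 * q + 2 * c)%R c c)).
      by apply: belowE => //; rewrite (actE_upd3 v bj bl jl).
    apply: belowE => //; rewrite (actE_upd3 v bj bl jl); congr upd3.
    by rewrite /incr; clear; lia.
  have ltc : (nrm (W (p - 2 * q - 2 * c)%R c c) < N)%N.
    by apply: lt; move: c0; rewrite /c; clear -q0 qp p2q; lia.
  apply: (edge_comp (v := W (p - 2 * q - 2 * c)%R c c)).
    by apply: belowE => //; rewrite (actE_upd3 v bj bl jl).
  apply: belowE => //; rewrite (actE_upd3 v bj bl jl); congr upd3.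
  by rewrite /incr; clear; lia.
have -> : e b l true * e b j false = (e j b false * e l b false)^-1 *
    ((e l j false * f l * e j l false * f j)^-1 *
     ((e b j false * e b l true) *
      ((e l j false * f l * e j l false * f j)^-1 *
       (e j b false * e l b false)))).
  apply: (mulgI (e j b false * e l b false)); rewrite mulVKg.
  by rewrite -(l2_e_row rel) // (row_difference_conj rel u) !mulgA.
have UgU := edge_comp (edge_comp (edge_comp Ex (edge_inv EU)) Eg) (edge_inv EU).
exact: edge_comp UgU (edge_inv Ex).
Qed.

(** As v_b is odd, it differs from 2 v_j. If it is larger, then |v_b - 4 v_j| < v_b and the
    commuting square closes below the peak; otherwise [conf_row_lt] applies. *)
Lemma conf_row_eq v j l : j \in A -> l \in A -> uniq [:: b; j; l] ->
  (nrm v <= N)%N -> (forall i, odd `|v i| = (i == b)) ->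
  v j = v l -> (0 < v j < v b)%R ->
  edge (e b l true * e b j false) (actE v b j true) (actE v b l true).
Proof.
move=> jA lA u vN vodd jl_eq jvb.
have bj : b != j by ord_uniq.
have bl : b != l by ord_uniq.
have [lt2|ge2] := ltrP (v b) (2 * v j)%R; first exact: conf_row_lt.
have gt2 : (2 * v j < v b)%R.
  by move: ge2 (vodd b); rewrite eqxx; clear; lia.
have nn s i : (nrm (actE v b i s) + `|v b| = nrm v + `|incr s (v b) (v i)|)%N.
  exact: nrm_actE.
apply: (@conf_square v b j b l true) => //.
- by rewrite (l2_e_row rel).
- by move: (nn true j) vN jvb gt2; rewrite /incr; clear; lia.
- by move: (nn true l) vN jvb gt2; rewrite -jl_eq /incr; clear; lia.
move: (nrm_actE (actE v b j true) b l true) (nn true j) vN jvb gt2.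
rewrite [actE v b j true b]updE [actE v b j true l]updE eqxx eq_sym.
by rewrite (negPf bl) -jl_eq /incr; clear; lia.
Qed.

Lemma conf_square_nneg v i j k l : i \in A -> j \in A -> k \in A -> l \in A ->
  i != j -> k != l -> i != l -> k != j -> i != k ->
  e i j false * e k l true = e k l true * e i j false ->
  (nrm v <= N)%N -> (0 < v j < v i)%R -> (0 < v l < v k)%R ->
  edge (e k l true * e i j false) (actE v i j true) (actE v k l true).
Proof.
move=> iA jA kA lA ij kl il kj ik eC vN ji lk.
apply: (@conf_square v i j k l true) => //;
  move: (nrm_actE v i j true) (nrm_actE v k l true)
    (nrm_actE2 v j true true ik il) vN ji lk;
  by rewrite /incr; clear; lia.
Qed.

(** Reducing values of different sizes form a fork. A tie is settled by [conf_row_eq] when i = b,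
    the only use of (3)(b), and by a detour through coordinate [b] otherwise. *)
Lemma conf_same_source v i j l : i \in A -> j \in A -> l \in A ->
  uniq [:: i; j; l] -> (nrm v <= N)%N ->
  (forall k, k \in A -> 0 <= v k)%R -> (forall k, odd `|v k| = (k == b)) ->
  (0 < v j < v i)%R -> (0 < v l < v i)%R ->
  edge (e i l true * e i j false) (actE v i j true) (actE v i l true).
Proof.
move=> iA jA lA u vN nneg vodd ji li.
have u' : uniq [:: i; l; j] by ord_uniq.
have [lj|jl|jl] := ltgtP (v l) (v j).
- by apply: conf_fork => //; move: lj ji li; clear; lia.
- have : edge (e i j true * e i l false) (actE v i l true) (actE v i j true).
    by apply: conf_fork => //; move: jl ji li; clear; lia.
  by move/edge_inv; rewrite invgM !(l2_eV rel).
have [ib|ib] := eqVneq i b; first by subst i; apply: conf_row_eq.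
have jb : j != b.
  apply/eqP=> jb; have := vodd l; have := vodd j; rewrite jl jb eqxx => ->.
  by move/esym/eqP=> lb; move: u; rewrite jb lb /= !inE eqxx andbF.
have lb : l != b by rewrite -vodd jl vodd.
have b0 : (0 < v b)%R.
  by move: (vodd b) (nneg b bA); rewrite eqxx; clear; lia.
have ne : v b != v j.
  by apply/eqP=> bj; have := vodd b; rewrite bj vodd eqxx (negPf jb).
(* A third reduction, involving the odd coordinate [b], is joined to both. *)
have [bj|jb_lt|eqbj] := ltgtP (v b) (v j); last by rewrite eqbj eqxx in ne.
  have : edge (e i b true * e i j false) (actE v i j true) (actE v i b true).
    by apply: conf_fork => //; [ord_uniq | move: b0 bj ji li jl; clear; lia..].
  have : edge (e i b true * e i l false) (actE v i l true) (actE v i b true).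
    by apply: conf_fork => //; [ord_uniq | move: b0 bj ji li jl; clear; lia..].
  move/edge_inv; rewrite invgM !(l2_eV rel) /= => lE jE.
  have := edge_comp jE lE; rewrite mulgA -(mulgA (e i l true)).
  by rewrite (e_mulV rel i b false) mulg1.
have ij : i != j by ord_uniq.
have il : i != l by ord_uniq.
have bj' : b != j by rewrite eq_sym.
have bl' : b != l by rewrite eq_sym.
have : edge (e b j true * e i j false) (actE v i j true) (actE v b j true).
  apply: conf_square_nneg => //; last by move: jb_lt ji; clear; lia.
  by rewrite (l2_e_col rel) //; ord_uniq.
have : edge (e b j true * e i l false) (actE v i l true) (actE v b j true).
  apply: conf_square_nneg => //; last by move: jb_lt ji; clear; lia.
  by rewrite (l2_e_disj rel) //; ord_uniq.
move/edge_inv; rewrite invgM !(l2_eV rel) /= => lE jE.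
have := edge_comp jE lE; rewrite mulgA -(mulgA (e i l true)).
by rewrite (e_mulV rel b j false) mulg1.
Qed.

Lemma conf_nneg v i j k l : i \in A -> j \in A -> k \in A -> l \in A ->
  i != j -> k != l -> (nrm v <= N)%N ->
  (forall m, m \in A -> 0 <= v m)%R -> (forall m, odd `|v m| = (m == b)) ->
  (0 < v j < v i)%R -> (0 < v l < v k)%R ->
  edge (e k l true * e i j false) (actE v i j true) (actE v k l true).
Proof.
move=> iA jA kA lA ij kl vN nneg vodd ji lk.
have [ik|ik] := eqVneq i k.
  subst k; have [jl|jl] := eqVneq j l; last first.
    by apply: conf_same_source => //; ord_uniq.
  by subst l; rewrite (e_mulV rel i j true) => q; rewrite mul1g.
have [jl|jl] := eqVneq j l.
  subst l; apply: conf_square_nneg => //.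
  by rewrite (l2_e_col rel) //; ord_uniq.
have [jk|jk] := eqVneq j k.
  (* Opposite pairs are impossible: each of v_i and v_j would be smaller than the other. *)
  subst k; have [il|il] := eqVneq i l; first by subst l; lia.
  by apply: conf_chain => //; [ord_uniq | lia..].
have [il|il] := eqVneq i l.
  subst l.
  have : edge (e i j true * e k i false) (actE v k i true) (actE v i j true).
    by apply: conf_chain => //; [ord_uniq | lia..].
  by move/edge_inv; rewrite invgM !(l2_eV rel).
apply: conf_square_nneg => //; first by rewrite eq_sym.
by rewrite (l2_e_disj rel) //; ord_uniq.
Qed.

Lemma reducing_nneg v i j s : (0 <= v i)%R -> (0 <= v j)%R ->
  (nrm (actE v i j s) < nrm v)%N -> s /\ (0 < v j < v i)%R.
Proof. by have := nrm_actE v i j s; rewrite /incr; case: s; clear; lia. Qed.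

(** Each sign change at a negative active coordinate conjugates the problem to one with fewer
    negative coordinates, down to [conf_nneg]. *)
Lemma conf v i j s k l t : i \in A -> j \in A -> k \in A -> l \in A ->
  i != j -> k != l -> (nrm v <= N)%N -> (forall m, odd `|v m| = (m == b)) ->
  (nrm (actE v i j s) < nrm v)%N -> (nrm (actE v k l t) < nrm v)%N ->
  edge (e k l t * e i j (~~ s)) (actE v i j s) (actE v k l t).
Proof.
move=> iA jA kA lA ij kl.
have [m] := ubnP #|[set a in A | (v a < 0)%R]|; elim: m v s t => // m IH v s t.
rewrite ltnS => negs vN vodd ns nt.
have [/existsP[a /andP[aA va]]|] := boolP [exists a, (a \in A) && (v a < 0)%R].
  have lt_neg : (#|[set a' in A | (actF v a a' < 0)%R]| < m)%N.
    apply: leq_trans negs; apply: proper_card; apply/properP; split.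
      apply/subsetP=> c; rewrite !inE updE; have [->|//] := eqVneq c a.
      by rewrite aA va.
    by exists a; rewrite !inE ?aA // updE eqxx; move: va; clear; lia.
  have Fodd c : odd `|actF v a c| = (c == b).
    by rewrite -vodd updE; have [->|//] := eqVneq c a; clear; lia.
  set s' := s (+) (a == i) (+) (a == j); set t' := t (+) (a == k) (+) (a == l).
  have := IH (actF v a) s' t' lt_neg.
  rewrite -!actFE // !nrm_actF => /(_ vN Fodd ns nt) E.
  have := edge_comp (edge_comp (edgeF (actE v i j s) aA) E)
     (edge_inv (edgeF (actE v k l t) aA)).
  have -> : (f a)^-1 * (e k l t' * e i j (~~ s') * f a) =
      e k l t * e i j (~~ s).
    apply: (mulgI (f a)); rewrite mulVKg mulgA (fe_any rel) // -!mulgA.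
    rewrite (fe_any rel) //.
    by rewrite /s' !addNb.
  by [].
rewrite negb_exists => /forallP nneg.
have {}nneg c : c \in A -> (0 <= v c)%R.
  by move=> cA; have := nneg c; rewrite cA /= -leNgt.
have [st jvi] := reducing_nneg (nneg i iA) (nneg j jA) ns.
have [tt lvk] := reducing_nneg (nneg k kA) (nneg l lA) nt.
by rewrite st tt; apply: conf_nneg.
Qed.

Lemma nrm_delta : nrm delta = 1%N.
Proof.
rewrite /nrm (bigD1 b) //= ffunE eqxx big1 // => i /negPf ib.
by rewrite ffunE ib.
Qed.

(** The descent of [v] begins with some reduction, which [conf] compares with the given one. The
    base vectors have norm 1 and cannot be reduced, the target having an odd coordinate. *)
Lemma desc_reduce v q k l t : k \in A -> l \in A -> k != l -> (nrm v <= N)%N ->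
  (nrm (actE v k l t) < nrm v)%N -> desc v q ->
  desc (actE v k l t) (e k l t * q).
Proof.
move=> kA lA kl vN nt vq; have vodd := desc_odd vq.
have nt0 : (0 < nrm (actE v k l t))%N.
  have := le_nrm (actE v k l t) b.
  have : odd `|actE v k l t b|.
    have := vodd b; rewrite updE eqxx /incr; have [<-|//] := eqVneq b k.
    by case: (t); clear; lia.
  by clear; lia.
case: vq vN nt nt0 vodd => {v q} [x _|x _|v q i j s iA jA ij ns vq]
  vN nt nt0 vodd.
- by move: nt nt0; rewrite nrm_delta; clear; lia.
- by move: nt nt0; rewrite nrm_actF nrm_delta; clear; lia.
have := conf iA jA kA lA ij kl vN vodd ns nt => /(_ (e i j s * q)) [+ _].
move/(_ vq); rewrite -mulgA (mulgA (e i j _)).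
by rewrite -{2}[s]negbK (e_mulV rel) mul1g.
Qed.

(** E_ij fixes [v], so it must preserve the coset. At the base it lies in [stab]; elsewhere it is
    pushed past the first reduction E_kl, leaving E_ij and, if i = l, two factors E_kj of equal
    sign, all of which fix the smaller vector. *)
Lemma desc_fix v q i j s : i \in A -> j \in A -> i != j -> (nrm v <= N)%N ->
  v j = 0%R -> desc v q -> desc v (e i j s * q).
Proof.
move=> iA jA ij vN vj0 vq.
have fixE u k c x : k \in A -> k != j -> (nrm u < N)%N -> u j = 0%R ->
    desc u x -> desc u (e k j c * x).
  move=> kA kj uN uj; have eu := actE_fix k c uj.
  by have := @below u k j c kA jA kj uN; rewrite eu => /(_ uN x) [].
case: vq vN vj0 => {v q} [x sx|x sx|v q k l t kA lA kl nt vq] vN vj0.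
- apply/desc_base/stabE => //; apply/eqP=> jb.
  by move: vj0; rewrite ffunE jb eqxx.
- have jb : j != b.
    by apply/eqP=> jb; move: vj0; rewrite updE !ffunE jb eqxx.
  rewrite mulgA (ef_any rel) // -mulgA; apply: desc_neg; exact: stabE.
have un : (nrm (actE v k l t) < N)%N by apply: leq_trans nt vN.
have v2 : v k != 0%R /\ v l != 0%R.
  by move: (nrm_actE v k l t) nt; rewrite /incr; case: (t); clear; lia.
have kj : k != j by apply/eqP=> kj; move: v2; rewrite kj vj0 eqxx; case.
have lj : l != j by apply/eqP=> lj; move: v2; rewrite lj vj0 eqxx; case.
have uj : actE v k l t j = 0%R by rewrite updE eq_sym (negPf kj).
have [il|il] := eqVneq i l; last first.
  have eC : e k l t * e i j s = e i j s * e k l t.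
    have [ik|ik] := eqVneq i k.
      by subst k; rewrite (l2_e_row rel) //; ord_uniq.
    by rewrite (l2_e_disj rel) //; ord_uniq.
  by apply: (desc_up kA lA kl nt); rewrite mulgA eC -mulgA; apply: fixE.
subst l; apply: (desc_up kA iA kl nt).
have ijk : uniq [:: i; j; k] by ord_uniq.
have kij : uniq [:: k; i; j] by ord_uniq.
have := xe_chainV rel 1 s t ijk; rewrite !mul1g mulgA => ->.
rewrite !(xe_row rel _ _ _ kij) -!mulgA.
have kj' : k != j by [].
by do 3!apply: (fixE) => //.
Qed.

(** The move sends v_i to -v_i, and parity excludes i = b and j = b. If |v_b| > |v_j|, reducing [b]
    by [j] commutes with the move and goes below it; if |v_b| < |v_j|, both [i] and [j] are first
    reduced by [b], along [flip_word]. *)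
Lemma desc_flip v q i j s : i \in A -> j \in A -> i != j -> (nrm v <= N)%N ->
  v j != 0%R -> v i = (if s then v j else - v j)%R -> desc v q ->
  desc (actE v i j s) (e i j s * q).
Proof.
move=> iA jA ij vN vj0 vi vq; have vodd := desc_odd vq.
have ib : i != b.
  apply/eqP=> ib; have := vodd i; have := vodd j; rewrite vi ib eqxx.
  have -> : (j == b) = false by rewrite -ib eq_sym (negPf ij).
  by case: (s); clear; lia.
have jb : j != b.
  rewrite -vodd; have := vodd i; rewrite vi (negPf ib); case: (s); clear; lia.
have bi : b != i by rewrite eq_sym.
have bj : b != j by rewrite eq_sym.
have ne : `|v b|%N <> `|v j|%N.
  by move=> bj_eq; have := vodd b; rewrite bj_eq vodd eqxx (negPf jb).
have b0 : v b != 0%R by move: (vodd b); rewrite eqxx; clear; lia.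
have zE : actE v i j s = upd3 v i j b (- v i)%R (v j) (v b).
  rewrite {1}(upd3_id v ij ib jb) (actE_upd3 v ij ib jb); congr upd3.
  by rewrite /incr vi; case: (s); clear; lia.
have nW a c : (nrm (upd3 v i j b a c (v b)) + (`|v i| + `|v j|) =
    nrm v + (`|a| + `|c|))%N.
  by move: (nrm_upd3 v a c (v b) ij ib jb); clear; lia.
have [b_lt|b_gt] := ltnP `|v b| `|v j|; last first.
  have [|t lt_t] := @incr_reduce (v b) (v j) vj0.
    by move: ne b_gt; clear; lia.
  have nt : (nrm (actE v b j t) < nrm v)%N.
    by move: (nrm_actE v b j t) lt_t; clear; lia.
  have eC : e b j t * e i j s = e i j s * e b j t.
    by rewrite (l2_e_col rel) //; ord_uniq.
  have aC : actE (actE v i j s) b j t = actE (actE v b j t) i j s.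
    exact: actEC.
  have nz : nrm (actE v i j s) = nrm v.
    by rewrite zE; move: (nW (- v i)%R (v j)); clear; lia.
  have nt' : (nrm (actE (actE v i j s) b j t) < nrm (actE v i j s))%N.
    move: (nrm_actE2 v j s t ib ij) (nrm_actE v b j t) nt; rewrite nz.
    by clear; lia.
  apply: (desc_up bA jA bj nt'); rewrite aC mulgA eC -mulgA.
  have uN : (nrm (actE v b j t) < N)%N by apply: leq_trans nt vN.
  apply/(below iA jA ij uN); last exact: desc_reduce.
  by rewrite -aC; apply: leq_trans nt' _; rewrite nz.
have [t lt_t] := incr_reduce b0 b_lt.
set c := incr t (v j) (v b) in lt_t.
set W := upd3 v i j b in zE nW *.
have ijb : uniq [:: i; j; b] by ord_uniq.
(* The sign is chosen so that the reduced entries [a] and [c] keep the relation between v_i and v_j;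
   E_ij then still negates the entry at [i]. *)
set a := incr (~~ (t (+) s)) (v i) (v b).
have ac : a = (if s then c else - c)%R.
  by rewrite /a /c vi /incr; case: (s) (t) => [] [] /=; clear; lia.
have w1E : actE v i b (~~ (t (+) s)) = W a (v j) (v b).
  by rewrite {1}(upd3_id v ij ib jb) (actE_upd3 v ij ib jb).
have wE : actE (W a (v j) (v b)) j b t = W a c (v b).
  by rewrite (actE_upd3 v ij ib jb).
have w'E : actE (W a c (v b)) i j s = W (- a)%R c (v b).
  rewrite (actE_upd3 v ij ib jb); congr upd3.
  by rewrite ac /incr; case: (s); clear; lia.
have up2 : actE (W (- a)%R (v j) (v b)) j b t = W (- a)%R c (v b).
  by rewrite (actE_upd3 v ij ib jb).
have up1 : actE (W (- v i)%R (v j) (v b)) i b (t (+) s) = W (- a)%R (v j) (v b).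
  rewrite (actE_upd3 v ij ib jb); congr upd3.
  by rewrite /a /incr; case: (_ (+) _) => /=; clear; lia.
have a_abs : `|a|%N = `|c|%N by rewrite ac; case: (s); clear; lia.
have vi_abs : `|v i|%N = `|v j|%N by rewrite vi; case: (s); clear; lia.
have n1 (x y : int) : `|x|%N = `|a|%N -> `|y|%N = `|v j|%N ->
    (nrm (W x y (v b)) < nrm v)%N.
  by move: (nW x y) lt_t; rewrite a_abs vi_abs; clear; lia.
have n2 (x : int) : `|x|%N = `|a|%N ->
    (nrm (W x c (v b)) < nrm (W x (v j) (v b)))%N.
  by move: (nW x c) (nW x (v j)) lt_t; rewrite a_abs; clear; lia.
have lt1 : (nrm (W a (v j) (v b)) < nrm v)%N by apply: n1.
have lt1' : (nrm (W (- a)%R (v j) (v b)) < nrm v)%N.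
  by apply: n1 => //; clear; lia.
have lt2 : (nrm (W a c (v b)) < N)%N.
  exact: leq_trans (leq_trans (n2 _ (erefl _)) (ltnW lt1)) vN.
have lt2s : (nrm (W (- a)%R c (v b)) < nrm (W (- a)%R (v j) (v b)))%N.
  by apply: n2; clear; lia.
have lt2' : (nrm (W (- a)%R c (v b)) < N)%N.
  exact: leq_trans (leq_trans lt2s (ltnW lt1')) vN.
have := desc_reduce iA bA ib vN _ vq; move=> /(_ (~~ (t (+) s))).
rewrite w1E => /(_ lt1) w1q.
have E1 : edge (e j b t) (W a (v j) (v b)) (W a c (v b)).
  by apply: belowE => //; apply: leq_trans lt1 vN.
have E2 : edge (e i j s) (W a c (v b)) (W (- a)%R c (v b)) by apply: belowE.
have := (E2 _).1 ((E1 _).1 w1q).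
rewrite (mulgA (e j b t)) mulgA (flip_word rel) // -!mulgA => w'q.
rewrite zE; apply: (desc_up iA bA ib (s := t (+) s)); rewrite up1.
  apply: leq_trans lt1' _; move: (nW (- v i)%R (v j)); clear; lia.
by apply: (desc_up jA bA jb (s := t)); rewrite up2.
Qed.

Lemma desc_level v q i j s : i \in A -> j \in A -> i != j -> (nrm v <= N)%N ->
  nrm (actE v i j s) = nrm v -> desc v q -> desc (actE v i j s) (e i j s * q).
Proof.
move=> iA jA ij vN n_eq vq; have [vj0|vj0] := eqVneq (v j) 0%R.
  by rewrite actE_fix //; apply: desc_fix.
apply: desc_flip => //.
by move: (nrm_actE v i j s) n_eq vj0; rewrite /incr; case: (s); clear; lia.
Qed.

Lemma desc_step v q i j s : i \in A -> j \in A -> i != j -> (nrm v <= N)%N ->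
  desc v q -> desc (actE v i j s) (e i j s * q).
Proof.
move=> iA jA ij vN vq.
have [lt|gt|eq] := ltngtP (nrm (actE v i j s)) (nrm v).
- exact: desc_reduce.
(* A norm-increasing step is undone by a reduction, so it extends the descent. *)
- apply: (desc_up iA jA ij (s := ~~ s)); rewrite actEK //.
  by rewrite mulgA -{2}[s]negbK (e_mulV rel) mul1g.
- exact: desc_level.
Qed.

End Below.

Lemma desc_actE v q i j s : i \in A -> j \in A -> i != j ->
  desc v q -> desc (actE v i j s) (e i j s * q).
Proof.
have [N] := ubnP (nrm v); elim: N v q i j s => // N IH v q i j s.
rewrite ltnS => vN iA jA ij vq.
apply: (@desc_step N) => // {v q i j s vN iA jA ij vq}.
move=> v i j s iA jA ij nv n_act q.
split; first exact: IH.
move/(IH _ _ i j (~~ s) n_act iA jA ij); rewrite actEK //.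
by rewrite mulgA -{2}[s]negbK (e_mulV rel) mul1g.
Qed.

End PeakReduction.

(** * Words acting trivially *)

Section Kernel.
Local Open Scope group_scope.
Variables (n : nat) (Q : groupType) (e : 'I_n -> 'I_n -> bool -> Q)
  (f : 'I_n -> Q).
Hypothesis rel : level2_relations e f.
Variable rho : Q -> vec n -> vec n.
Hypothesis rho1 : forall v, rho 1 v = v.
Hypothesis rhoM : forall x y v, rho (x * y) v = rho x (rho y v).
Hypothesis rhoE : forall i j s v, i != j -> rho (e i j s) v = actE v i j s.
Hypothesis rhoF : forall i v, rho (f i) v = actF v i.
Implicit Types (i j k b : 'I_n) (u v w : vec n) (t x q : Q) (A : {set 'I_n}).

Inductive gen A : Q -> Prop :=
| gen1 : gen A 1
| genE i j s x of i \in A & j \in A & i != j & gen A x : gen A (e i j s * x)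
| genF i x of i \in A & gen A x : gen A (f i * x).

Lemma gen_desc A b q : b \in A -> gen A q -> desc e f A b (rho q (delta b)) q.
Proof.
move=> bA; elim=> {q} [|i j s x iA jA ij _ IH|i x iA _ IH].
- by rewrite rho1; apply/desc_base/stab1.
- by rewrite rhoM rhoE //; apply: desc_actE.
- by rewrite rhoM rhoF; apply: desc_actF.
Qed.

Lemma desc_nrm_gt0 A b v q : desc e f A b v q -> (0 < nrm v)%N.
Proof.
move/desc_odd/(_ b); rewrite eqxx; move: (le_nrm v b); clear; lia.
Qed.

(** Only the base constructor is possible: a reduction of [delta] would reach norm 0, and the
    opposite vector differs at [b]. *)
Lemma desc_delta A b q : desc e f A b (delta b) q -> stab e f A b q.
Proof.
move E : (delta b) => v vq; case: vq E => {v q} [//|x _ /ffunP/(_ b)|].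
  by rewrite updE !ffunE eqxx.
move=> v q i j s _ _ _ lt /desc_nrm_gt0 gt0 vE; move: lt gt0.
by rewrite -vE nrm_delta; clear; lia.
Qed.

Lemma gen_fix A b q v : b \notin A -> gen A q -> rho q v b = v b.
Proof.
move=> bA; elim=> {q} [|i j s x iA jA ij _ IH|i x iA _ IH].
- by rewrite rho1.
- rewrite rhoM rhoE // updE -IH; case: eqP => // bi.
  by rewrite bi iA in bA.
- rewrite rhoM rhoF updE -IH; case: eqP => // bi.
  by rewrite bi iA in bA.
Qed.

(** * The commuting generators E_bj and their complement in [stab] *)

Section Row.
Variables (A : {set 'I_n}) (b : 'I_n).

Inductive row_word : Q -> Prop :=
| row_word1 : row_word 1
| row_wordE j s t of j \in A & b != j & row_word t : row_word (e b j s * t).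

(** Passing E_ij over E_bi produces only E_bj factors, so row words are normalized by the generators
    avoiding [b]. *)
Lemma row_word_conjE i j s t :
  i \in A -> j \in A -> i != j -> b != i -> b != j ->
  row_word t -> exists2 t', row_word t' & e i j s * t = t' * e i j s.
Proof.
move=> iA jA ij bi bj; elim=> {t} [|k c t kA bk _ [t' tW' IH]].
  by exists 1; [exact: row_word1 | rewrite mulg1 mul1g].
have [ik|ik] := eqVneq i k.
  subst k; set d := ~~ (s (+) c).
  exists (e b i c * (e b j d * (e b j d * t'))).
    by do !apply: row_wordE.
  have ijb : uniq [:: i; j; b] by ord_uniq.
  rewrite mulgA (l2_e_chain rel _ _ ijb) -/d -!mulgA; congr (_ * _).
  rewrite mulgA (l2_e_col rel _ _ ijb) -mulgA; congr (_ * _).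
  by rewrite mulgA (l2_e_col rel _ _ ijb) -mulgA IH.
exists (e b k c * t'); first exact: row_wordE.
rewrite mulgA -[RHS]mulgA -IH [RHS]mulgA; congr (_ * _).
have [jk|jk] := eqVneq j k.
  by subst k; rewrite (l2_e_col rel) //; ord_uniq.
by rewrite (l2_e_disj rel) //; ord_uniq.
Qed.

Lemma row_word_conjF i t : b != i ->
  row_word t -> exists2 t', row_word t' & f i * t = t' * f i.
Proof.
move=> bi; elim=> {t} [|k c t kA bk _ [t' tW' IH]].
  by exists 1; [exact: row_word1 | rewrite mulg1 mul1g].
exists (e b k (c (+) (i == b) (+) (i == k)) * t'); first exact: row_wordE.
by rewrite mulgA (fe_any rel) // -!mulgA IH.
Qed.

Lemma stab_split q : b \in A -> stab e f A b q ->
  exists t x, [/\ row_word t, gen (A :\ b) x & q = t * x].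
Proof.
move=> bA; elim=> {q} [|i j s x iA jA ij jb _ [t [w [tW ww ->]]]
  |i x iA ib _ [t [w [tW ww ->]]]].
- by exists 1, 1; split; [exact: row_word1 | exact: gen1 | rewrite mulg1].
- have [ib|ib] := eqVneq b i.
    subst i; exists (e b j s * t), w; split=> //; last by rewrite mulgA.
    exact: row_wordE.
  have [|t' tW' tE] := row_word_conjE s iA jA ij ib _ tW.
    by rewrite eq_sym.
  exists t', (e i j s * w); rewrite !mulgA tE; split=> //.
  by apply: genE => //; rewrite !inE ?iA ?jA ?jb // eq_sym ib.
- have [|t' tW' tE] := @row_word_conjF i t _ tW; first by rewrite eq_sym.
  exists t', (f i * w); rewrite !mulgA tE; split=> //.
  by apply: genF => //; rewrite !inE ib iA.
Qed.

Definition epow j (z : int) : Q :=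
  match z with Posz k => e b j false ^+ k | Negz k => e b j true ^+ k.+1 end.

Lemma e_epow j s z : e b j s * epow j z = epow j (if s then z - 1 else z + 1)%R.
Proof.
have ft : e b j false * e b j true = 1 := e_mulV rel b j false.
have tf : e b j true * e b j false = 1 := e_mulV rel b j true.
case: s; case: z => [[|k]|k].
- by rewrite /= mulg1.
- have -> : (Posz k.+1 - 1)%R = Posz k by lia.
  by rewrite /= expgS mulgA tf mul1g.
- have -> : (Negz k - 1)%R = Negz k.+1 by lia.
  by rewrite /= [RHS]expgS.
- by rewrite /= mulg1.
- have -> : (Posz k.+1 + 1)%R = Posz k.+2 by lia.
  by rewrite /= [RHS]expgS.
case: k => [|k]; first by rewrite /= ft.
have -> : (Negz k.+1 + 1)%R = Negz k by lia.
by rewrite /= expgS mulgA ft mul1g.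
Qed.

Lemma rho_epow j z v : b != j ->
  rho (epow j z) v = upd v b (v b + 2 * z * v j)%R.
Proof.
move=> bj.
have act s (y : int) : rho (e b j s) (upd v b y) = upd v b (incr s y (v j)).
  rewrite rhoE //; apply/ffunP=> m.
  rewrite /actE !updE eqxx [j == b]eq_sym (negPf bj).
  by case: eqP.
elim/int_rec: z => [|k IH|k IH].
- rewrite rho1; apply/ffunP=> m; rewrite updE mulr0 mul0r addr0.
  by case: eqP => [->|].
- have -> : epow j k.+1 = e b j false * epow j k.
    by rewrite e_epow; congr epow; clear; lia.
  by rewrite rhoM IH act; congr upd; rewrite /incr; clear; lia.
have -> : epow j (- k.+1%:Z)%R = e b j true * epow j (- k%:Z)%R.
  by rewrite e_epow; congr epow; clear; lia.
by rewrite rhoM IH act; congr upd; rewrite /incr; clear; lia.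
Qed.

(** Since the E_bj commute, one exponent per index suffices; repetitions are merged by [e_epow]. *)
Inductive row_normal : seq 'I_n -> Q -> Prop :=
| row_normal_nil : row_normal [::] 1
| row_normal_cons j z s t of row_normal s t :
    row_normal (j :: s) (epow j z * t).

Lemma row_normal1 s : row_normal s 1.
Proof.
elim: s => [|j s IH]; first exact: row_normal_nil.
by rewrite -[1]mulg1; apply: (row_normal_cons j 0).
Qed.

Lemma row_normalE s j c t : j \in s -> b != j -> b \notin s -> row_normal s t ->
  row_normal s (e b j c * t).
Proof.
move=> js bj bs st; elim: st js bs => {s t} // k z s t st IH.
rewrite !inE; have [-> _ _|jk] := eqVneq j k.
  by rewrite mulgA e_epow; apply: row_normal_cons.
rewrite negb_or /= => js /andP[bk bs].
have eC : e b j c * epow k z = epow k z * e b j c.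
  have ek d : commute (e b j c) (e b k d) by apply: (l2_e_row rel); ord_uniq.
  by case: z => m; apply: commuteX.
by rewrite mulgA eC -mulgA; apply/row_normal_cons/IH.
Qed.

Lemma row_normal_fix s t v : b \notin s -> row_normal s t ->
  (forall k, k \in s -> v k = 0)%R -> rho t v = v.
Proof.
move=> bs st; elim: st bs => {s t} [|k z s t st IH] bs v0.
  by rewrite rho1.
move: bs; rewrite inE negb_or => /andP[bk bs].
rewrite rhoM IH // => [|k' k's]; last by rewrite v0 // inE k's orbT.
rewrite rho_epow // (v0 k) ?mem_head // mulr0 addr0.
by apply/ffunP=> m; rewrite updE; case: eqP => [->|].
Qed.

(** The exponent [z] of E_bk is visible in the image of the basis vector at [k], whose entry at [b]
    is 2z because the later factors fix that vector. *)
Lemma row_normal_faithful s t : uniq s -> b \notin s -> row_normal s t ->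
  (forall v, rho t v = v) -> t = 1.
Proof.
move=> us bs st; elim: st us bs => {s t} [//|k z s t st IH] /andP[ks us].
rewrite inE negb_or => /andP[bk bs] tid.
have z0 : z = 0%R.
  have := tid (delta k); rewrite rhoM (row_normal_fix bs st); last first.
    by move=> m ms; rewrite ffunE; case: eqP ms ks => // -> ->.
  rewrite rho_epow // => /ffunP/(_ b).
  by rewrite updE !ffunE !eqxx (negPf bk); clear; lia.
have k1 : epow k z = 1 by rewrite z0.
by rewrite k1 mul1g; apply: IH => // v; have := tid v; rewrite k1 mul1g.
Qed.

Lemma row_word_fix k t v : k != b -> row_word t -> rho t v k = v k.
Proof.
move=> kb; elim=> {t} [|j s t _ bj _ IH]; first by rewrite rho1.
by rewrite rhoM rhoE // updE (negPf kb).
Qed.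

Lemma row_word_faithful t : row_word t -> (forall v, rho t v = v) -> t = 1.
Proof.
move=> tW; apply: (@row_normal_faithful (enum (~: [set b]))).
- exact: enum_uniq.
- by rewrite mem_enum !inE eqxx.
elim: tW => {t} [|j s t _ bj _ IH]; first exact: row_normal1.
by apply: row_normalE => //; rewrite mem_enum !inE ?eqxx // eq_sym.
Qed.

End Row.

Theorem gen_faithful A q : gen A q -> (forall v, rho q v = v) -> q = 1.
Proof.
have [m] := ubnP #|A|; elim: m A q => // m IH A q; rewrite ltnS => Am qA qid.
have [A0|[b bA]] := set_0Vmem A.
  by case: qA => // [i j s x|i x]; rewrite A0 inE.
have : desc e f A b (delta b) q by rewrite -{1}(qid (delta b)); apply: gen_desc.
move/desc_delta/(stab_split bA) => [t [x [tW xA qE]]].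
have b_notin : b \notin A :\ b by rewrite !inE eqxx.
(* [t] changes at most coordinate [b], while [x] is a bijection preserving it; as t x acts
   trivially, so does [t]. *)
have t1 : t = 1.
  apply: row_word_faithful (tW) _ => u.
  have [v vu] : exists v, rho x v = u.
    by exists (rho x^-1 u); rewrite -rhoM mulgV rho1.
  apply/ffunP=> k; have [->|kb] := eqVneq k b; last exact: row_word_fix kb tW.
  by rewrite -vu -rhoM -qE qid (gen_fix _ b_notin xA).
move: qE qid; rewrite t1 mul1g => -> xid.
apply: IH xA xid; apply: leq_trans Am.
by rewrite [in leqRHS](cardsD1 b) bA.
Qed.

End Kernel.

(** * The relators hold in Gamma_2(n) *)

Section MatrixAction.
Local Open Scope ring_scope.
Variable n : nat.
Implicit Types (i j k : 'I_n) (v : vec n) (M N : 'M[int]_n).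

Definition actM M v : vec n := [ffun i => \sum_j M i j * v j].

Lemma actM1 v : actM 1%:M v = v.
Proof.
apply/ffunP=> i; rewrite ffunE (bigD1 i) //= mxE eqxx mul1r.
rewrite big1 ?addr0 // => j ji.
by rewrite mxE eq_sym (negPf ji) mul0r.
Qed.

Lemma actMM M N v : actM (M *m N) v = actM M (actM N v).
Proof.
apply/ffunP=> i; rewrite !ffunE.
under eq_bigr do rewrite mxE mulr_suml.
rewrite exchange_big /=; apply: eq_bigr => j _; rewrite ffunE mulr_sumr.
by apply: eq_bigr => k _; rewrite mulrA.
Qed.

Lemma actM_delta M i j : actM M (delta j) i = M i j.
Proof.
rewrite ffunE (bigD1 j) //= ffunE eqxx mulr1 big1 ?addr0 // => k kj.
by rewrite ffunE (negPf kj) mulr0.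
Qed.

Lemma actM_inj M : (forall v, actM M v = v) -> M = 1%:M.
Proof.
move=> Mid; apply/matrixP=> i j.
by rewrite -actM_delta Mid ffunE mxE -natz.
Qed.

Lemma actM_Emx i j v : actM (Emx i j) v = actE v i j false.
Proof.
apply/ffunP=> k; rewrite updE ffunE.
under eq_bigr do rewrite !mxE mulrDl.
rewrite big_split /= (bigD1 k) //= eqxx mul1r big1 ?addr0; last first.
  by move=> m mk; rewrite eq_sym (negPf mk) mul0r.
have [ki|ki] := eqVneq k i; last first.
  by rewrite big1 ?addr0 // => m _; rewrite mulr0 mul0r.
rewrite ki (bigD1 j) //= eqxx mulr1 big1 ?addr0 // => m mj.
by rewrite (negPf mj) mulr0 mul0r.
Qed.

Lemma actM_Fmx i v : actM (Fmx i) v = actF v i.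
Proof.
apply/ffunP=> k; rewrite updE ffunE (bigD1 k) //= big1 ?addr0; last first.
  by move=> m mk; rewrite !mxE [k == m]eq_sym (negPf mk) mulr0n mul0r.
by rewrite !mxE eqxx mulr1n; case: eqP => [->|_]; rewrite ?mulN1r ?mul1r.
Qed.

End MatrixAction.

(** * Words acting on vectors through Gamma_2(n) *)

Section WordAction.
Local Open Scope group_scope.
Variable n : nat.
Implicit Types (i j k l : 'I_n) (v : vec n) (g h : Gamma2 n)
  (w x y : free_group (gens n)).

Definition actG g v : vec n := actM (GLmx (Gamma2_val g)) v.

Lemma actG1 v : actG 1 v = v. Proof. exact: actM1. Qed.

Lemma actGM g h v : actG (g * h) v = actG g (actG h v).
Proof. exact: actMM. Qed.

Lemma actG_inj g : (forall v, actG g v = v) -> g = 1.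
Proof. by move=> gid; do 2!apply: val_inj; apply: actM_inj. Qed.

Definition lift2 : free_group (gens n) -> Gamma2 n := free_lift (@Gamma2_gen n).

Lemma liftM x y : lift2 (x * y) = lift2 x * lift2 y.
Proof. exact: free_lift_is_group_morphism. Qed.

Lemma lift1 : lift2 1 = 1.
Proof. by apply: (mulgI (lift2 1)); rewrite -liftM !mulg1. Qed.

Lemma liftV x : lift2 x^-1 = (lift2 x)^-1.
Proof. by apply/esym/mulg1_eq; rewrite -liftM mulgV lift1. Qed.

Definition act w v := actG (lift2 w) v.

Lemma act1 v : act 1 v = v. Proof. by rewrite /act lift1 actG1. Qed.

Lemma actMw x y v : act (x * y) v = act x (act y v).
Proof. by rewrite /act liftM actGM. Qed.

Lemma actKV x v : act x^-1 (act x v) = v.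
Proof. by rewrite -actMw mulVg act1. Qed.

Lemma act_E i j v : i != j -> act (E i j) v = actE v i j false.
Proof.
move=> ij; rewrite /act /E.
rewrite (insubT (fun p : 'I_n * 'I_n => p.1 != p.2) (x := (i, j)) ij).
by rewrite /lift2 free_lift_gen; apply: actM_Emx.
Qed.

Lemma act_EV i j v : i != j -> act (E i j)^-1 v = actE v i j true.
Proof.
move=> ij; rewrite -[in LHS](actEK v true ij) -act_E //; exact: actKV.
Qed.

Lemma act_F i v : act (F i) v = actF v i.
Proof. by rewrite /act /F /lift2 free_lift_gen; apply: actM_Fmx. Qed.

Lemma act_commg x y v : (forall u, act (x * y) u = act (y * x) u) ->
  act [~ x, y] v = v.
Proof.
move=> xy; by rewrite commgEl conjgE !actMw -(actMw x y) xy actMw !actKV.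
Qed.

Section Triple.
Variables (v : vec n) (i j k : 'I_n).
Hypotheses (ij : i != j) (ik : i != k) (jk : j != k).
Notation W := (upd3 v i j k).

Lemma actF_upd3_i a c d : actF (W a c d) i = W (- a)%R c d.
Proof using ij ik jk. by rewrite /upd3; vec_eq. Qed.

(** Both entries of (3)(b) act on the triple as translations along (1, 1, 1) by an amount depending
    only on differences of coordinates. Such translations preserve these differences, hence
    commute. *)
Lemma act_triple1 a c d :
  act (E j i * F j * E i j * F i * (E k i)^-1 * E k j) (W a c d) =
  W (a - 2 * (a - c))%R (c - 2 * (a - c))%R (d - 2 * (a - c))%R.
Proof.
rewrite !actMw !act_F !(act_E, act_EV) //; try by rewrite eq_sym.
rewrite !(actE_upd3 v ij ik jk, actF_upd3_i).
by congr upd3; rewrite /incr; clear; lia.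
Qed.

Lemma act_triple2 a c d :
  act (E k i * F k * E i k * F i * (E j i)^-1 * E j k) (W a c d) =
  W (a - 2 * (a - d))%R (c - 2 * (a - d))%R (d - 2 * (a - d))%R.
Proof.
rewrite !actMw !act_F !(act_E, act_EV) //; try by rewrite eq_sym.
rewrite !(actE_upd3 v ij ik jk, actF_upd3_i).
by congr upd3; rewrite /incr; clear; lia.
Qed.

End Triple.

(** The action on vectors is faithful, so each relator is checked on coordinates instead of by
    multiplying matrices. *)
Lemma lift_relator r : Gamma2_relator r -> lift2 r = 1.
Proof.
move=> rr; apply: actG_inj => v; rewrite -/(act r v).
case: rr v => {r} [i|i j ij|i j ij|i j ij|i j k u|i j k u|i j k u|i j k u
  |i j k u|i j k l u] v.
- by rewrite expg2 actMw !act_F actFK.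
- rewrite expg2 !actMw !act_F !act_E //; vec_eq.
- rewrite expg2 !actMw !act_F !act_E //; vec_eq.
- by rewrite expg2 !actMw !act_F; vec_eq.
- have [ij ik jk] : [/\ i != j, i != k & j != k] by split; ord_uniq.
  by apply: act_commg => w; rewrite !actMw !act_E //; vec_eq.
- have [ij ik jk] : [/\ i != j, i != k & j != k] by split; ord_uniq.
  have kj : k != j by rewrite eq_sym.
  by apply: act_commg => w; rewrite !actMw !act_E //; vec_eq.
- have [ij ik jk] : [/\ i != j, i != k & j != k] by split; ord_uniq.
  by apply: act_commg => w; rewrite !actMw !act_F !act_E //; vec_eq.
- have [ij ik jk] : [/\ i != j, i != k & j != k] by split; ord_uniq.
  have kj : k != j by rewrite eq_sym.
  have ki : k != i by rewrite eq_sym.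
  rewrite commgEl conjgE expg2 !actMw !act_E // !act_EV //.
  by vec_eq.
- have [ij ik jk] : [/\ i != j, i != k & j != k].
    by split; rewrite -val_eqE /=; move: u; clear; lia.
  (* The patterns match each commutator entry as a whole, keeping the shape that [act_triple1] and
     [act_triple2] expect. *)
  apply: act_commg => w; rewrite !(actMw (_ * E k j)) !(actMw (_ * E j k)).
  rewrite (upd3_id w ij ik jk).
  rewrite !(act_triple1 w ij ik jk, act_triple2 w ij ik jk).
  by congr upd3; clear; lia.
have [ij ik il] : [/\ i != j, i != k & i != l] by split; ord_uniq.
have [jk jl kl] : [/\ j != k, j != l & k != l] by split; ord_uniq.
by apply: act_commg => w; rewrite !actMw !act_E //; vec_eq.
Qed.

Lemma lift_normal_closure w :
  normal_closure (@Gamma2_relator n) w -> lift2 w = 1.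
Proof.
elim=> {w} [r /lift_relator //||x y _ x1 _ y1|x _ x1|x y _ x1].
- exact: lift1.
- by rewrite liftM x1 y1 mulg1.
- by rewrite liftV x1 invg1.
by rewrite conjgE !liftM liftV x1 mul1g mulVg.
Qed.

End WordAction.

(** * Words trivial in Gamma_2(n) are consequences of the relators *)

Section Injectivity.
Local Open Scope group_scope.
Variable n : nat.
Implicit Types (i j k l : 'I_n) (v : vec n) (w x y : free_group (gens n)).

(** The chosen representative is immaterial, relators acting trivially; see [rho_pi2]. *)
Definition rho (q : G2pres n) v : vec n := act (repr q) v.

Lemma rho_pi2 w v : rho (pi2 w) v = act w v.
Proof.
have /ncl_piP/lift_normal_closure := ncl_pi_repr (pi2 w).
rewrite liftM liftV => /mulg1_eq; rewrite invgK => rE.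
by rewrite /rho /act rE.
Qed.

Lemma rho1 v : rho 1 v = v.
Proof. by rewrite -(gmulf1 (s := @pi2 n)) rho_pi2 act1. Qed.

Lemma rhoM (p q : G2pres n) v : rho (p * q) v = rho p (rho q v).
Proof.
rewrite -[p]ncl_pi_repr -[q]ncl_pi_repr -[_ * _](pi2M (repr p) (repr q)).
by rewrite !rho_pi2 actMw.
Qed.

Lemma rhoE i j s v : i != j -> rho (pE i j s) v = actE v i j s.
Proof.
move=> ij; case: s; last by rewrite rho_pi2 act_E.
by rewrite /pE -pi2V rho_pi2 act_EV.
Qed.

Lemma rhoF i v : rho (pF i) v = actF v i.
Proof. by rewrite rho_pi2 act_F. Qed.

Lemma fgen_inl (ij : offdiag n) :
  fgen (inl ij : gens n) = E (val ij).1 (val ij).2.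
Proof.
case: ij => [[i j] /= ij].
by rewrite /E (insubT (fun p : 'I_n * 'I_n => p.1 != p.2) (x := (i, j)) ij).
Qed.

Lemma gen_pi2 w : gen (@pE n) (@pF n) setT (pi2 w).
Proof.
case: w => s rs; elim: s rs => [|[x c] s IH] rs.
  have -> : Free rs = 1 by apply: val_inj.
  by rewrite [pi2 1](gmulf1 (s := @pi2 n)); apply: gen1.
have rs' : reduced s := path_sorted rs.
have -> : Free rs = (if c then (fgen x)^-1 else fgen x) * Free rs'.
  apply: val_inj => /=.
  have -> : free_word (if c then (fgen x)^-1 else fgen x) = [:: (x, c)].
    by case: c {rs}.
  by case: (s) rs => //= b t /andP[/negPf ->].
rewrite pi2M; case: x {rs} => [ij|i].
  have -> : pi2 (if c then (fgen (inl ij : gens n))^-1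
                 else fgen (inl ij : gens n)) = pE (val ij).1 (val ij).2 c.
    by rewrite fgen_inl /pE; case: c; rewrite ?pi2V.
  by apply: genE; rewrite ?inE //; exact: valP ij.
have -> : pi2 (if c then (fgen (inr i : gens n))^-1
               else fgen (inr i : gens n)) = pF i.
  rewrite -[fgen _]/(F i); case: c; last by [].
  by rewrite pi2V -[pi2 _]/(pF i) pF_inv.
by apply: genF; rewrite ?inE.
Qed.

Lemma lift_kernel w : lift2 w = 1 -> normal_closure (@Gamma2_relator n) w.
Proof.
move=> w1; apply/ncl_pi_eq1.
apply: (gen_faithful (pres_relations n) rho1 rhoM rhoE rhoF (gen_pi2 w)) => v.
by rewrite rho_pi2 /act w1 actG1.
Qed.

End Injectivity.

(** * Finiteness of the set of relators *)

Section Finiteness.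

Definition listable (U : eqType) (P : U -> Prop) :=
  exists s : seq U, forall u, P u <-> u \in s.

Lemma listable_or (U : eqType) (P P' : U -> Prop) :
  listable P -> listable P' -> listable (fun u => P u \/ P' u).
Proof.
move=> [s sP] [s' sP']; exists (s ++ s') => u; rewrite mem_cat.
split=> [[/sP->//|/sP'->]|/orP[/sP|/sP']]; rewrite ?orbT //; tauto.
Qed.

Lemma listable_image (T : finType) (U : eqType) (D : pred T) (g : T -> U) :
  listable (fun u => exists2 t, D t & u = g t).
Proof.
exists [seq g t | t <- enum D] => u; split=> [[t Dt ->]|/mapP[t]].
  by apply: map_f; rewrite mem_enum.
by rewrite mem_enum => Dt ->; exists t.
Qed.

Lemma eq_listable (U : eqType) (P P' : U -> Prop) :
  (forall u, P u <-> P' u) -> listable P -> listable P'.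
Proof. by move=> PP' [s sP]; exists s => u; rewrite -PP'. Qed.

Local Open Scope group_scope.

Lemma listable_relator n : listable (@Gamma2_relator n).
Proof.
pose pair := ('I_n * 'I_n)%type; pose triple := (pair * 'I_n)%type.
pose d2 (p : pair) := p.1 != p.2.
pose d3 (p : triple) := uniq [:: p.1.1; p.1.2; p.2].
pose lt3 (p : triple) := (p.1.1 < p.1.2 < p.2)%N.
pose d4 (p : triple * 'I_n) := uniq [:: p.1.1.1; p.1.1.2; p.1.2; p.2].
have := listable_or (listable_image xpredT (fun i : 'I_n => F i ^+ 2))
  (listable_or (listable_image d2 (fun p => (E p.1 p.2 * F p.1) ^+ 2))
  (listable_or (listable_image d2 (fun p => (E p.1 p.2 * F p.2) ^+ 2))
  (listable_or (listable_image d2 (fun p => (F p.1 * F p.2) ^+ 2))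
  (listable_or (listable_image d3 (fun p => [~ E p.1.1 p.1.2, E p.1.1 p.2]))
  (listable_or (listable_image d3 (fun p => [~ E p.1.1 p.1.2, E p.2 p.1.2]))
  (listable_or (listable_image d3 (fun p => [~ E p.1.1 p.1.2, F p.2]))
  (listable_or (listable_image d3 (fun p =>
    [~ E p.1.1 p.1.2, E p.2 p.1.1] * E p.2 p.1.2 ^+ 2))
  (listable_or (listable_image lt3 (fun p => let: ((i, j), k) := p in
      [~ E j i * F j * E i j * F i * (E k i)^-1 * E k j,
         E k i * F k * E i k * F i * (E j i)^-1 * E j k]))
  (listable_image d4 (fun p => [~ E p.1.1.1 p.1.1.2, E p.1.2 p.2])))))))))).
apply: eq_listable => r; split.
  case=> [[i _ ->]|]; first exact: rel_F2.
  case=> [[[i j] ij ->]|]; first exact: rel_EFi.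
  case=> [[[i j] ij ->]|]; first exact: rel_EFj.
  case=> [[[i j] ij ->]|]; first exact: rel_FF.
  case=> [[[[i j] k] u ->]|]; first exact: rel_row.
  case=> [[[[i j] k] u ->]|]; first exact: rel_col.
  case=> [[[[i j] k] u ->]|]; first exact: rel_EFk.
  case=> [[[[i j] k] u ->]|]; first exact: rel_EE.
  case=> [[[[i j] k] u ->]|]; first exact: rel_triple.
  by case=> [[[[i j] k] l] u ->]; exact: rel_disjoint.
case=> {r} [i|i j u|i j u|i j u|i j k u|i j k u|i j k u|i j k u|i j k u
  |i j k l u].
- by left; exists i.
- by right; left; exists (i, j).
- by do 2!right; left; exists (i, j).
- by do 3!right; left; exists (i, j).
- by do 4!right; left; exists (i, j, k).
- by do 5!right; left; exists (i, j, k).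
- by do 6!right; left; exists (i, j, k).
- by do 7!right; left; exists (i, j, k).
- by do 8!right; left; exists (i, j, k).
by do 9!right; exists (i, j, k, l).
Qed.

End Finiteness.

(** * Generation of Gamma_2(n) *)

Section Generation.
Local Open Scope group_scope.
Variable n : nat.
Implicit Types (i j k b : 'I_n) (v : vec n) (g h : Gamma2 n)
  (w x y : free_group (gens n)) (A : {set 'I_n}).

Lemma intr_Z2 (z : int) : (z%:~R = (odd `|z|)%:R :> 'Z_2)%R.
Proof.
have two m : (m%:R = (odd m)%:R :> 'Z_2)%R.
  rewrite -[m in LHS]odd_double_half natrD -mul2n natrM.
  by rewrite [(2%:R)%R](_ : _ = 0%R) ?mul0r ?addr0 //; apply/val_inj.
case: z => m; first by rewrite -two.
rewrite NegzE rmorphN abszN -two.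
by apply/eqP; rewrite eq_sym -subr_eq0 opprK -natrD two addnn odd_double.
Qed.

Definition entry g i j : int := GLmx (Gamma2_val g) i j.

Lemma odd_entry g i j : odd `|entry g i j| = (i == j).
Proof.
have /eqP/(congr1 (fun M : GL 'Z_2 n => GLmx M i j)) := valP g.
rewrite /= !mxE intr_Z2 /entry => H.
by case: odd H; case: (i == j) => // /(congr1 val).
Qed.

Lemma entryE g i j : entry g i j = actG g (delta j) i.
Proof. by rewrite /actG actM_delta. Qed.

Lemma entryM g h i j : entry (g * h) i j = actG g (actG h (delta j)) i.
Proof. by rewrite entryE actGM. Qed.

Lemma entry1 i j : entry 1 i j = Posz (i == j).
Proof. by rewrite entryE actG1 ffunE. Qed.

Lemma actG_upd g v b (a : int) i :
  (actG g (upd v b a) i + entry g i b * v b = actG g v i + entry g i b * a)%R.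
Proof.
rewrite !ffunE (bigD1 b) //= [in RHS](bigD1 b) //= updE eqxx.
rewrite (eq_bigr (fun j => GLmx (Gamma2_val g) i j * v j)%R); last first.
  by move=> j /negPf jb; rewrite updE jb.
by rewrite addrAC [RHS]addrAC; congr (_ + _)%R; rewrite addrC.
Qed.

(** The copy of the level 2 congruence group on the indices in [A]. *)
Definition blk A g :=
  forall i j, (i \notin A) || (j \notin A) -> entry g i j = Posz (i == j).

Lemma blk_mul A g h : blk A g -> blk A h -> blk A (g * h).
Proof.
move=> gA hA i j ijA; rewrite entryM.
have gi v : i \notin A -> actG g v i = v i.
  move=> iA; rewrite ffunE (bigD1 i) //= -/(entry g i i) gA ?iA // eqxx mul1r.
  rewrite big1 ?addr0 // => k ki; rewrite -/(entry g i k) gA ?iA //.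
  by rewrite eq_sym (negPf ki) mul0r.
have [iA|iA] := boolP (i \in A); last by rewrite gi // -entryE hA ?iA.
have jA : j \notin A by move: ijA; rewrite iA.
have -> : actG h (delta j) = delta j.
  by apply/ffunP=> k; rewrite -entryE hA ?jA ?orbT // ffunE.
by rewrite -entryE gA ?jA ?orbT.
Qed.

Lemma blk_E A i j s : i \in A -> j \in A -> i != j ->
  blk A (lift2 (if s then (E i j)^-1 else E i j)).
Proof.
move=> iA jA ij k l klA; rewrite entryE -/(act _ _).
have -> : act (if s then (E i j)^-1 else E i j) (delta l) =
    actE (delta l) i j s.
  by case: s; rewrite ?act_EV ?act_E.
rewrite updE !ffunE; case: eqP => [ki|_]; last by [].
subst k; have lA : l \notin A by rewrite iA in klA.
have [jl|_] := eqVneq j l; first by rewrite -jl jA in lA.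
by rewrite /incr mulr0 subr0 ?addr0 if_same.
Qed.

Lemma blk_F A i : i \in A -> blk A (lift2 (F i)).
Proof.
move=> iA k l klA; rewrite entryE -/(act _ _) act_F updE !ffunE.
case: eqP => [ki|_]; last by [].
have lA : l \notin A by rewrite ki iA in klA.
by rewrite ki; have [il|_] := eqVneq i l; first by rewrite -il iA in lA.
Qed.

(** A Euclidean algorithm with steps of twice an entry: v_b is odd and v_j even, so their absolute
    values differ and the larger one can be shortened by the other as long as v_j is nonzero. *)
Lemma reduce_col A b v : b \in A -> (forall i, odd `|v i| = (i == b)) ->
  (forall k, k \notin A -> v k = 0%R) ->
  exists2 w, blk A (lift2 w) & forall k, k != b -> act w v k = 0%R.
Proof.
move=> bA; have [m] := ubnP (nrm v); elim: m v => // m IH v; rewrite ltnS.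
move=> vm vodd vA.
have [/existsP[j /andP[jb vj]]|] :=
  boolP [exists j, (j != b) && (v j != 0%R)]; last first.
  rewrite negb_exists => /forallP v0; exists 1.
    by move=> i j _; rewrite lift1 entry1.
  move=> k kb; rewrite act1; have := v0 k; rewrite kb /= negbK => /eqP//.
have jA : j \in A by apply: contraR vj => /vA ->.
have bj : b != j by rewrite eq_sym.
have step p q s : p \in A -> q \in A -> p != q ->
    (`|incr s (v p) (v q)| < `|v p|)%N ->
    exists2 w, blk A (lift2 w) & forall k, k != b -> act w v k = 0%R.
  move=> pA qA pq lt; have lt_n : (nrm (actE v p q s) < m)%N.
    by move: (nrm_actE v p q s) lt vm; clear; lia.
  have odd' i : odd `|actE v p q s i| = (i == b).
    rewrite -vodd /actE updE /incr; have [->|//] := eqVneq i p.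
    by case: (s); clear; lia.
  have [k kA|w wA w0] := IH _ lt_n odd'.
    by rewrite updE; case: eqP => [kp|_]; [rewrite kp pA in kA | apply: vA].
  exists (w * (if s then (E p q)^-1 else E p q)).
    by rewrite liftM; apply: blk_mul wA _; apply: blk_E.
  move=> k kb; rewrite actMw.
  have -> : act (if s then (E p q)^-1 else E p q) v = actE v p q s.
    by case: (s); rewrite ?act_EV ?act_E.
  exact: w0.
have vb : v b != 0%R by move: (vodd b); rewrite eqxx; clear; lia.
have [lt|gt|eq] := ltngtP `|v b| `|v j|.
- by have [t] := incr_reduce vb lt; apply: step.
- by have [t] := incr_reduce vj gt; apply: step.
by have := vodd b; rewrite eq vodd eqxx (negPf jb).
Qed.

(** Column [b] being standard, right multiplication by E_bj or its inverse changes only the entry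
    (b, j), by 2. That entry is even, so steps of the right sign shrink it to 0. *)
Lemma clear_row A b g : b \in A -> blk A g ->
  (forall k, entry g k b = Posz (k == b)) ->
  exists w, blk (A :\ b) (g * lift2 w).
Proof.
move=> bA; have [m] := ubnP (\sum_j `|entry g b j|)%N; elim: m g => // m IH g.
rewrite ltnS => gm gA gb.
have [/existsP[j /andP[jb gj]]|] :=
  boolP [exists j, (j != b) && (entry g b j != 0%R)]; last first.
  rewrite negb_exists => /forallP g0; exists 1; rewrite lift1 mulg1 => i j.
  rewrite !inE !negb_and !negbK => ijA.
  have [->|jb] := eqVneq j b; first exact: gb.
  have [->|ib] := eqVneq i b.
    by have := g0 j; rewrite jb negbK => /eqP->; rewrite eq_sym (negPf jb).
  by apply: gA; move: ijA; rewrite (negPf jb) (negPf ib).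
have bj : b != j by rewrite eq_sym.
have jA : j \in A.
  by apply: contraR gj => jA; rewrite gA ?jA ?orbT // (negPf bj).
pose s := (0 < entry g b j)%R.
pose x := if s then (E b j)^-1 else E b j.
have gxE i k : entry (g * lift2 x) i k =
    if (i == b) && (k == j) then incr s (entry g b j) 1 else entry g i k.
  rewrite entryM -/(act x _).
  have -> : act x (delta k) = actE (delta k) b j s.
    by rewrite /x; case: (s); rewrite ?act_EV ?act_E.
  have := actG_upd g (delta k) b (incr s (delta k b) (delta k j)) i.
  rewrite -/(actE (delta k) b j s) -entryE gb [delta k b]ffunE [delta k j]ffunE.
  have [->|kj] := eqVneq k j; last first.
    rewrite andbF /incr mulr0 subr0 ?addr0 if_same.
    exact: addIr.
  rewrite (negPf bj) andbT; have [->|ib] := eqVneq i b.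
    rewrite /incr /=; case: (s); clear; lia.
  by rewrite !mul0r !addr0.
have [|||w wA] := IH (g * lift2 x).
- apply: leq_trans gm; rewrite (bigD1 j) //= [in leqRHS](bigD1 j) //=.
  rewrite gxE !eqxx /=.
  rewrite (eq_bigr (fun k => `|entry g b k|%N)); last first.
    by move=> k kj; rewrite gxE (negPf kj) andbF.
  rewrite -addSn leq_add2r /s; move: gj (odd_entry g b j).
  rewrite (negPf bj) /incr.
  by case: ltrP; clear; lia.
- by rewrite /x; apply: blk_mul gA _; apply: blk_E.
- by move=> k; rewrite gxE (negPf bj) andbF.
by exists (x * w); rewrite liftM mulgA.
Qed.

Lemma entry_unit b g : (forall k, k != b -> entry g k b = 0%R) ->
  `|entry g b b|%N = 1%N.
Proof.
move=> g0; have : entry (g^-1 * g) b b = 1%R by rewrite mulVg entry1 eqxx.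
rewrite entryM ffunE (bigD1 b) //= big1 ?addr0.
  rewrite -entryE => /(congr1 absz); rewrite abszM => /eqP.
  by rewrite muln_eq1 => /andP[_ /eqP].
by move=> k kb; rewrite -entryE g0 ?mulr0.
Qed.

(** Column [b] is reduced to its diagonal entry, which is a unit and is made 1 by F_b if necessary;
    clearing row [b] leaves a block on the remaining indices, treated by induction. *)
Lemma lift_blk A g : blk A g -> exists w, lift2 w = g.
Proof.
have [m] := ubnP #|A|; elim: m A g => // m IH A g; rewrite ltnS => Am gA.
have [A0|[b bA]] := set_0Vmem A.
  exists 1; rewrite lift1; apply/esym/actG_inj => v; apply/ffunP=> i.
  rewrite ffunE (bigD1 i) //= -/(entry g i i) gA ?A0 ?inE // eqxx mul1r.
  rewrite big1 ?addr0 // => k ki; rewrite -/(entry g i k) gA ?A0 ?inE //.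
  by rewrite eq_sym (negPf ki) mul0r.
have [||w1 w1A w10] := @reduce_col A b (actG g (delta b)) bA.
- by move=> i; rewrite -entryE odd_entry.
- move=> k kA; rewrite -entryE gA ?kA //; case: eqP => // kb.
  by rewrite kb bA in kA.
have g1A := blk_mul w1A gA; set g1 := lift2 w1 * g in g1A.
have g1b k : k != b -> entry g1 k b = 0%R.
  by move=> kb; rewrite /g1 entryM; apply: w10.
have [w2 w2A g2b] : exists2 w2, blk A (lift2 w2 * g1) &
    forall k, entry (lift2 w2 * g1) k b = Posz (k == b).
  have := entry_unit g1b; have [g1bb|g1bb] := eqVneq (entry g1 b b) 1%R => u.
    exists 1; rewrite lift1 mul1g // => k.
    by have [->|kb] := eqVneq k b; [rewrite g1bb | rewrite g1b].
  exists (F b); first exact: blk_mul (blk_F bA) g1A.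
  move=> k; rewrite entryM -/(act _ _) act_F updE -!entryE.
  have [_|kb] := eqVneq k b; last exact: g1b.
  by move: u g1bb; clear; lia.
have [w3 w3A] := clear_row bA w2A g2b.
have [|w4 w4E] := IH (A :\ b) _ _ w3A.
  by apply: leq_trans Am; rewrite [in leqRHS](cardsD1 b) bA.
exists (w1^-1 * w2^-1 * w4 * w3^-1).
rewrite !liftM w4E !liftV -!mulgA mulgV mulg1.
by rewrite mulKg mulKg.
Qed.

Lemma lift_surjective g : exists w, lift2 w = g.
Proof. by apply: (@lift_blk setT) => i j; rewrite !inE. Qed.

End Generation.

Theorem theorem1p1 (n : nat) (n_ge1 : (1 <= n)%N) :
  is_finite_presentation (@Gamma2_gen n) (@Gamma2_relator n).
Proof.
split; first exact: listable_relator.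
split; first exact: lift_surjective.
by move=> w; split; [apply: lift_kernel | apply: lift_normal_closure].
Qed.
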